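(* Let $\mathfrak{g}$ be a finite-dimensional complex Lie algebra. In the two-parameter family $\overline{\mathcal{G}}_{(e_1,e_2)}$ of current algebras, the current algebras for the singular cubic cases are isomorphic as follows: $$\overline{\mathcal{G}}_{(0,0)}\cong\overline{\mathfrak{g}}=\mathfrak{g}\otimes\mathbb{C}[z,z^{-1}],\qquad \overline{\mathcal{G}}^{1}\cong\overline{\mathcal{G}}^{-2}\cong\mathfrak{g}\otimes\mathcal{V},\qquad \overline{\mathcal{G}}^{-1/2}\cong\mathfrak{g}\otimes\mathcal{W}.$$
   Context: For $e_1,e_2\in\mathbb{C}$, $\overline{\mathcal{G}}_{(e_1,e_2)}$ is the Lie algebra on $\mathfrak{g}\otimes V$, $V$ with basis $\{A_n\mid n\in\mathbb{Z}\}$, with bracket $[x\otimes A_n,y\otimes A_m]=[x,y]\otimes A_{n+m}$ if $n$ or $m$ is even and $[x\otimes A_n,y\otimes A_m]=[x,y]\otimes\big(A_{n+m}+3e_1A_{n+m-2}+(e_1-e_2)(2e_1+e_2)A_{n+m-4}\big)$ if $n,m$ are both odd. For $s\in\mathbb{C}$ all algebras $\overline{\mathcal{G}}_{(e_1,e_2)}$ with $e_2=se_1$, $e_1\neq0$, are isomorphic, and $\overline{\mathcal{G}}^s$ denotes this isomorphism type. The singular cubics $Y^2=4(X-e_1)(X-e_2)(X+e_1+e_2)$ are those with $(e_1,e_2)=(0,0)$ or $e_2=se_1$, $e_1\neq 0$, $s\in\{1,-2,-1/2\}$. For a commutative associative algebra $\mathcal{A}$, $\mathfrak{g}\otimes\mathcal{A}$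 has bracket $[x\otimes f,y\otimes g]=[x,y]\otimes fg$. For $\alpha\in\mathbb{C}\setminus\{0\}$, $\mathcal{V}_{(\alpha)}$ is the algebra of meromorphic functions on $\mathbb{P}^1(\mathbb{C})$ holomorphic outside $\{\alpha,-\alpha,\infty\}$, and $\mathcal{W}_{(\alpha)}$ is the algebra of meromorphic functions on $\mathbb{P}^1(\mathbb{C})$ holomorphic outside $\{0,\infty\}$ and taking the same value at $\alpha$ and $-\alpha$. The isomorphism types do not depend on $\alpha\neq0$ and are denoted $\mathcal{V}$ and $\mathcal{W}$. *)

(* Defs.v *)
From HB Require Import structures.
From mathcomp Require Import all_boot all_order all_algebra finmap complex.
From mathcomp Require Import boolp classical_sets functions reals topology.
From mathcomp Require Import normedtype derive.
From mathcomp Require Import zify.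
(* The notations of monalg clash with those of mathcomp-analysis. *)
From mathcomp Require monalg.
Import -(notations) monalg.

Set Implicit Arguments.
Unset Strict Implicit.
Unset Printing Implicit Defensive.

Import Order.TTheory GRing.Theory Num.Theory numFieldNormedType.Exports.

Local Open Scope ring_scope.

HB.mixin Record Lmodule_isLie (K : nzRingType) L of GRing.Lmodule K L := {
  lie : L -> L -> L;
  lie_linearl : forall y, linear (lie^~ y);
  lie_linearr : forall x, linear (lie x);
  liexx : forall x, lie x x = 0;
  jacobi : forall x y z,
    lie x (lie y z) + lie y (lie z x) + lie z (lie x y) = 0
}.

#[short(type="lieAlgType")]
HB.structure Definition LieAlgebra (K : nzRingType) :=
  {L of GRing.Lmodule K L & Lmodule_isLie K L}.

#[short(type="finLieAlgType")]
HB.structure Definition FinLieAlgebra (K : nzRingType) :=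
  {L of Vector K L & LieAlgebra K L}.

Definition lie_isom (K : nzRingType) (L1 L2 : lieAlgType K) : Prop :=
  exists phi : {linear L1 -> L2},
    bijective phi /\ {morph phi : x y / lie x y}.

HB.instance Definition _ (K : nzRingType) (L : lieAlgType K) (x : L) :=
  GRing.isLinear.Build K L L *:%R (lie x) (lie_linearr x).

Lemma lie0l (K : nzRingType) (L : lieAlgType K) (y : L) : lie 0 y = 0.
Proof.
by have := lie_linearl y (-1) 0 0; rewrite scaler0 addr0 scaleN1r addNr.
Qed.

Section TensorProduct.
Variables (K : fieldType) (g : vectType K).

(* [tensor g A] is a coordinate model of the tensor product of [g] and [A]:
   since [g] has a finite basis b, it is the direct sum of the b_i (x) A.  The
   lemmas [tens_linearl], [tens_linearr] and [tensor_univ] show that it has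
   the universal property, so that it does not depend on the basis. *)
Definition tensor (A : Type) : Type := {ffun 'I_(\dim {:g}) -> A}.

HB.instance Definition _ (A : lmodType K) := GRing.Lmodule.on (tensor A).

Variable A : lmodType K.

Definition tens (x : g) (f : A) : tensor A :=
  [ffun i => coord (vbasis {:g}) i x *: f].

Lemma tens_linearl f : linear (tens^~ f).
Proof.
move=> a x y; apply/ffunP => i.
by rewrite !ffunE linearP scalerDl scalerA.
Qed.

Lemma tens_linearr x : linear (tens x).
Proof.
move=> a f h; apply/ffunP => i.
by rewrite !ffunE scalerDr !scalerA mulrC.
Qed.

HB.instance Definition _ x :=
  GRing.isLinear.Build K A (tensor A) *:%R (tens x) (tens_linearr x).

Lemma tens0l f : tens 0 f = 0.
Proof. by apply/ffunP => i; rewrite !ffunE linear0 scale0r. Qed.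

Lemma tensDl x y f : tens (x + y) f = tens x f + tens y f.
Proof. by have := tens_linearl f 1 x y; rewrite !scale1r. Qed.

Lemma tensZl a x f : tens (a *: x) f = a *: tens x f.
Proof. by have := tens_linearl f a x 0; rewrite tens0l !addr0. Qed.

Lemma tens_suml (I : Type) (r : seq I) (F : I -> g) f :
  tens (\sum_(i <- r) F i) f = \sum_(i <- r) tens (F i) f.
Proof.
elim: r => [|i r ih]; first by rewrite !big_nil tens0l.
by rewrite !big_cons tensDl ih.
Qed.

Lemma tensorE (u : tensor A) :
  u = \sum_(i < \dim {:g}) tens (vbasis {:g})`_i (u i).
Proof.
apply/ffunP => j; rewrite sum_ffunE (bigD1 j) //= ffunE coord_free; last first.
  exact: basis_free (vbasisP _).
rewrite eqxx scale1r big1 ?addr0 // => i ne_ij.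
rewrite ffunE coord_free ?(basis_free (vbasisP _)) //.
case: eqP => [eq_ji|_]; last by rewrite mulr0n scale0r.
by rewrite eq_ji eqxx in ne_ij.
Qed.

Lemma tensor_ind (P : tensor A -> Prop) :
    P 0 -> (forall x f u, P u -> P (tens x f + u)) -> forall u, P u.
Proof.
move=> P0 PD u; rewrite (tensorE u).
by elim/big_rec: _ => // i v _; exact: PD.
Qed.

Lemma tensor_univ (W : lmodType K) (b : g -> A -> W) :
    (forall f, linear (b^~ f)) -> (forall x, linear (b x)) ->
  exists h : {linear tensor A -> W}, (forall x f, h (tens x f) = b x f) /\
    forall h' : {linear tensor A -> W},
      (forall x f, h' (tens x f) = b x f) -> h' =1 h.
Proof.
move=> bl br.
pose h (u : tensor A) := \sum_(i < \dim {:g}) b (vbasis {:g})`_i (u i).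
have hlin : linear h.
  move=> a u v; rewrite /h scaler_sumr -big_split /=.
  by apply: eq_bigr => i _; rewrite !ffunE br.
pose H : {linear tensor A -> W} :=
  HB.pack h (GRing.isLinear.Build K (tensor A) W *:%R h hlin).
have b0 f : b 0 f = 0.
  by have := bl f (-1) 0 0; rewrite scaler0 addr0 scaleN1r addNr.
have bx0 x : b x 0 = 0.
  by have := br x (-1) 0 0; rewrite scaler0 addr0 scaleN1r addNr.
have bZr a x f : b x (a *: f) = a *: b x f.
  by have := br x a f 0; rewrite bx0 !addr0.
have Ht x f : H (tens x f) = b x f.
  rewrite [RHS](_ : _ = b (\sum_(i < \dim {:g}) coord (vbasis {:g}) i x *:
                             (vbasis {:g})`_i) f); last first.
    by rewrite -coord_vbasis // memvf.
  rewrite /H /= /h.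
  rewrite (big_morph (b^~ f) (id1 := 0) (op1 := +%R)); last first.
  - exact: b0.
  - by move=> y z; have := bl f 1 y z; rewrite !scale1r.
  apply: eq_bigr => i _; rewrite ffunE bZr.
  by have := bl f (coord (vbasis {:g}) i x) (vbasis {:g})`_i 0; rewrite b0 !addr0.
exists H; split=> // H' H't u.
by elim/tensor_ind: u => [|x f u ih]; rewrite ?linear0 // !linearD H't Ht ih.
Qed.
End TensorProduct.

Section LieTheory.
Variables (K : nzRingType) (L : lieAlgType K).
Implicit Types x y z : L.

Lemma lieDl x y z : lie (x + y) z = lie x z + lie y z.
Proof. by have := lie_linearl z 1 x y; rewrite !scale1r. Qed.

Lemma lie_suml (I : Type) (r : seq I) (F : I -> L) y :
  lie (\sum_(i <- r) F i) y = \sum_(i <- r) lie (F i) y.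
Proof.
elim: r => [|i r ih]; first by rewrite !big_nil lie0l.
by rewrite !big_cons lieDl ih.
Qed.

Lemma lieC x y : lie x y = - lie y x.
Proof.
apply/eqP; rewrite -addr_eq0; apply/eqP.
by have := liexx (x + y); rewrite lieDl !linearD /= !liexx add0r addr0.
Qed.
End LieTheory.

Fact addrACA3 (V : nmodType) (a b c d e f : V) :
  a + b + (c + d) + (e + f) = a + c + e + (b + d + f).
Proof. by rewrite (addrACA a) addrACA. Qed.

Section CurrentAlgebra.
Variables (K : fieldType) (g : finLieAlgType K) (A : comAlgType K).

Definition current : Type := tensor g A.

HB.instance Definition _ := GRing.Lmodule.on current.

(* The bilinear extension of [x (x) f, y (x) h] = [x, y] (x) fh (see
   [lie_tens]). *)
Definition current_lie (u v : current) : current :=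
  \sum_(i < \dim {:g}) \sum_(j < \dim {:g})
    tens (lie (vbasis {:g})`_i (vbasis {:g})`_j) (u i * v j).

Fact current_lie_linearl v : linear (current_lie^~ v).
Proof.
move=> a u1 u2; rewrite /current_lie scaler_sumr -big_split.
apply: eq_bigr => i _.
rewrite scaler_sumr -big_split; apply: eq_bigr => j _ /=.
by rewrite !ffunE mulrDl -scalerAl linearP.
Qed.

Fact current_lie_linearr u : linear (current_lie u).
Proof.
move=> a v1 v2; rewrite /current_lie scaler_sumr -big_split.
apply: eq_bigr => i _.
rewrite scaler_sumr -big_split; apply: eq_bigr => j _ /=.
by rewrite !ffunE mulrDr -scalerAr linearP.
Qed.

Fact current_lie_tens x f y h :
  current_lie (tens x f) (tens y h) = tens (lie x y) (f * h).
Proof.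
rewrite {2}(coord_vbasis (memvf x)) {2}(coord_vbasis (memvf y)).
transitivity (\sum_(i < \dim {:g}) \sum_(j < \dim {:g})
   tens (lie (coord (vbasis {:g}) i x *: (vbasis {:g})`_i)
             (coord (vbasis {:g}) j y *: (vbasis {:g})`_j)) (f * h)).
  apply: eq_bigr => i _; apply: eq_bigr => j _.
  rewrite !ffunE -scalerAl -scalerAr scalerA linearZ /=.
  rewrite -[in LHS]tensZl linearZ /=; congr (tens _ _).
  have := lie_linearl (vbasis {:g})`_j (coord (vbasis {:g}) i x)
    (vbasis {:g})`_i 0.
  by rewrite lie0l !addr0 => ->; rewrite scalerA mulrC.
under eq_bigr do rewrite -tens_suml -linear_sum /=.
rewrite -tens_suml; congr (tens _ _).
by rewrite lie_suml.
Qed.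

Fact current_lieDl u1 u2 v :
  current_lie (u1 + u2) v = current_lie u1 v + current_lie u2 v.
Proof. by have := current_lie_linearl v 1 u1 u2; rewrite !scale1r. Qed.

Fact current_lieDr u v1 v2 :
  current_lie u (v1 + v2) = current_lie u v1 + current_lie u v2.
Proof. by have := current_lie_linearr u 1 v1 v2; rewrite !scale1r. Qed.

Fact current_lie0l v : current_lie 0 v = 0.
Proof.
by have := current_lie_linearl v (-1) 0 0; rewrite scaler0 addr0 scaleN1r addNr.
Qed.

Fact current_lie0r u : current_lie u 0 = 0.
Proof.
by have := current_lie_linearr u (-1) 0 0; rewrite scaler0 addr0 scaleN1r addNr.
Qed.

Fact current_lieC u v : current_lie u v = - current_lie v u.
Proof.
elim/tensor_ind: u => [|x f u ih]; first
  by rewrite current_lie0l current_lie0r oppr0.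
rewrite current_lieDl current_lieDr opprD ih; congr (_ + _).
elim/tensor_ind: v {ih} => [|y h v ih].
  by rewrite current_lie0l current_lie0r oppr0.
rewrite current_lieDl current_lieDr opprD ih; congr (_ + _).
rewrite !current_lie_tens lieC mulrC -scaleN1r tensZl.
by rewrite scaleN1r.
Qed.

Fact current_liexx u : current_lie u u = 0.
Proof.
elim/tensor_ind: u => [|x f u ih]; first by rewrite current_lie0l.
rewrite current_lieDl !current_lieDr ih addr0 (current_lieC u) addrK.
by rewrite current_lie_tens liexx tens0l.
Qed.

Fact current_jacobi u v w :
  current_lie u (current_lie v w) + current_lie v (current_lie w u)
    + current_lie w (current_lie u v) = 0.
Proof.
elim/tensor_ind: u => [|x f u ihu].
  by rewrite !(current_lie0l, current_lie0r, addr0).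
rewrite !(current_lieDl, current_lieDr) addrACA3 ihu addr0 {ihu u}.
elim/tensor_ind: v => [|y h v ihv].
  by rewrite !(current_lie0l, current_lie0r, addr0).
rewrite !(current_lieDl, current_lieDr).
rewrite addrACA3 ihv addr0 {ihv v}.
elim/tensor_ind: w => [|z k w ihw].
  by rewrite !(current_lie0l, current_lie0r, addr0).
rewrite !(current_lieDl, current_lieDr).
rewrite addrACA3 ihw addr0 {ihw w}.
rewrite !current_lie_tens.
have -> : h * (k * f) = f * (h * k) by rewrite mulrA mulrC.
have -> : k * (f * h) = f * (h * k) by rewrite mulrC mulrA.
by rewrite -!tensDl jacobi tens0l.
Qed.

HB.instance Definition _ := Lmodule_isLie.Build K current
  current_lie_linearl current_lie_linearr current_liexx current_jacobi.

Lemma lie_tens (x y : g) (f h : A) :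
  lie (tens x f : current) (tens y h : current) = tens (lie x y) (f * h).
Proof. exact: current_lie_tens. Qed.
End CurrentAlgebra.

Section ZSpace.
Variable K : fieldType.

(* The vector space with basis [zbasis n], n in Z. *)
Definition zspace : Type := monalg.malg int K.

HB.instance Definition _ := GRing.Lmodule.on zspace.

Definition zbasis (n : int) : zspace := monalg.mkmalgU n 1.

Definition bilin_ext (c : int -> int -> zspace) (f g : zspace) : zspace :=
  \sum_(n <- monalg.msupp f) \sum_(m <- monalg.msupp g)
    (monalg.mcoeff n f * monalg.mcoeff m g) *: c n m.

Lemma zbasisE (f : zspace) :
  f = \sum_(n <- monalg.msupp f) monalg.mcoeff n f *: zbasis n.
Proof.
rewrite {1}[f]monalg.monalgE; apply: eq_bigr => n _.
apply/monalg.malgP => k.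
by rewrite monalg.mcoeffZ !monalg.mcoeffU mulrnAr mulr1.
Qed.

Lemma zspace_ind (P : zspace -> Prop) :
    P 0 -> (forall a n f, P f -> P (a *: zbasis n + f)) -> forall f, P f.
Proof.
by move=> P0 PD f; rewrite (zbasisE f); elim/big_rec: _ => // n u _; exact: PD.
Qed.

Lemma zsum_widen (V : lmodType K) (f : zspace) (d : {fset int}) (F : int -> V) :
  (monalg.msupp f `<=` d)%fset ->
  \sum_(n <- monalg.msupp f) monalg.mcoeff n f *: F n =
  \sum_(n <- d) monalg.mcoeff n f *: F n.
Proof.
move=> sfd; apply: big_fset_incl => // n _ nf.
by rewrite monalg.mcoeff_outdom ?scale0r.
Qed.

Lemma zsum_linear (V : lmodType K) (F : int -> V) :
  linear (fun f : zspace =>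
    \sum_(n <- monalg.msupp f) monalg.mcoeff n f *: F n).
Proof.
move=> a f g.
pose d :=
  (monalg.msupp (a *: f + g) `|` monalg.msupp f `|` monalg.msupp g)%fset.
rewrite !(@zsum_widen _ _ d); last 3 first.
- by rewrite /d fsubsetUr.
- by rewrite /d -fsetUA fsetUCA fsubsetUl.
- by rewrite /d -fsetUA fsubsetUl.
rewrite scaler_sumr -big_split; apply: eq_bigr => n _ /=.
by rewrite monalg.mcoeffD monalg.mcoeffZ scalerDl scalerA.
Qed.

Variable c : int -> int -> zspace.

Lemma bilin_extE f g : bilin_ext c f g =
  \sum_(n <- monalg.msupp f) monalg.mcoeff n f *:
    (\sum_(m <- monalg.msupp g) monalg.mcoeff m g *: c n m).
Proof.
apply: eq_bigr => n _; rewrite scaler_sumr.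
by apply: eq_bigr => m _; rewrite scalerA.
Qed.

Lemma bilin_ext_linearl g : linear ((bilin_ext c)^~ g).
Proof. by move=> a f1 f2; rewrite !bilin_extE zsum_linear. Qed.

Lemma bilin_ext_linearr f : linear (bilin_ext c f).
Proof.
move=> a g1 g2; rewrite !bilin_extE scaler_sumr -big_split.
apply: eq_bigr => n _ /=.
by rewrite zsum_linear scalerDr !scalerA mulrC.
Qed.

Lemma bilin_extDl f1 f2 g :
  bilin_ext c (f1 + f2) g = bilin_ext c f1 g + bilin_ext c f2 g.
Proof. by have := bilin_ext_linearl g 1 f1 f2; rewrite !scale1r. Qed.
Lemma bilin_extDr f g1 g2 :
  bilin_ext c f (g1 + g2) = bilin_ext c f g1 + bilin_ext c f g2.
Proof. by have := bilin_ext_linearr f 1 g1 g2; rewrite !scale1r. Qed.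
Lemma bilin_ext0l g : bilin_ext c 0 g = 0.
Proof.
by have := bilin_ext_linearl g (-1) 0 0; rewrite scaler0 addr0 scaleN1r addNr.
Qed.
Lemma bilin_ext0r f : bilin_ext c f 0 = 0.
Proof.
by have := bilin_ext_linearr f (-1) 0 0; rewrite scaler0 addr0 scaleN1r addNr.
Qed.
Lemma bilin_extZl a f g : bilin_ext c (a *: f) g = a *: bilin_ext c f g.
Proof. by have := bilin_ext_linearl g a f 0; rewrite bilin_ext0l !addr0. Qed.
Lemma bilin_extZr a f g : bilin_ext c f (a *: g) = a *: bilin_ext c f g.
Proof. by have := bilin_ext_linearr f a g 0; rewrite bilin_ext0r !addr0. Qed.

Lemma bilin_ext_zbasis n m : bilin_ext c (zbasis n) (zbasis m) = c n m.
Proof.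
rewrite /bilin_ext !monalg.msuppU oner_eq0 !big_seq_fset1.
by rewrite !monalg.mcoeffU !eqxx mulr1 scale1r.
Qed.

Hypothesis cC : forall n m, c n m = c m n.
Hypothesis c0 : forall n, c 0 n = zbasis n.
Hypothesis cA : forall n m k,
  bilin_ext c (zbasis n) (c m k) = bilin_ext c (c n m) (zbasis k).

Lemma bilin_extC : commutative (bilin_ext c).
Proof.
have zC n g : bilin_ext c (zbasis n) g = bilin_ext c g (zbasis n).
  elim/zspace_ind: g => [|b m g ih]; first by rewrite bilin_ext0l bilin_ext0r.
  by rewrite bilin_extDl bilin_extDr ih bilin_extZl bilin_extZr
    !bilin_ext_zbasis cC.
move=> f g; elim/zspace_ind: f => [|a n f ih].
  by rewrite bilin_ext0l bilin_ext0r.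
by rewrite bilin_extDl bilin_extDr ih bilin_extZl bilin_extZr zC.
Qed.

Lemma bilin_ext1 : left_id (zbasis 0) (bilin_ext c).
Proof.
elim/zspace_ind => [|a n f ih]; first by rewrite bilin_ext0r.
by rewrite bilin_extDr ih bilin_extZr bilin_ext_zbasis c0.
Qed.

Lemma bilin_extA : associative (bilin_ext c).
Proof.
have A1 n m h : bilin_ext c (zbasis n) (bilin_ext c (zbasis m) h) =
    bilin_ext c (bilin_ext c (zbasis n) (zbasis m)) h.
  elim/zspace_ind: h => [|d k h ih]; first by rewrite !bilin_ext0r.
  by rewrite !bilin_extDr ih !bilin_extZr !bilin_ext_zbasis cA.
have A2 n g h : bilin_ext c (zbasis n) (bilin_ext c g h) =
    bilin_ext c (bilin_ext c (zbasis n) g) h.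
  elim/zspace_ind: g => [|b m g ih].
    by rewrite bilin_ext0l !bilin_ext0r bilin_ext0l.
  rewrite bilin_extDl !bilin_extDr bilin_extDl ih.
  by rewrite bilin_extZl !bilin_extZr bilin_extZl A1.
move=> f g h; elim/zspace_ind: f => [|a n f ih]; first by rewrite !bilin_ext0l.
by rewrite !bilin_extDl ih !bilin_extZl A2.
Qed.

Lemma zbasis_neq0 n : zbasis n != 0.
Proof. by rewrite monalg.monalgU_eq0 oner_eq0. Qed.

End ZSpace.

(* K[z, z^-1], with [zbasis K n] in the role of z^n. *)
Section Laurent.
Variable K : fieldType.

Definition laurent : Type := zspace K.

HB.instance Definition _ := GRing.Lmodule.on laurent.

Definition laurent_coef (n m : int) : zspace K := zbasis K (n + m).

Definition laurent_mul (f g : laurent) : laurent := bilin_ext laurent_coef f g.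

Fact laurent_coefC n m : laurent_coef n m = laurent_coef m n.
Proof. by rewrite /laurent_coef addrC. Qed.

Fact laurent_coef0 n : laurent_coef 0 n = zbasis K n.
Proof. by rewrite /laurent_coef add0r. Qed.

Fact laurent_coefA n m k :
  bilin_ext laurent_coef (zbasis K n) (laurent_coef m k) =
  bilin_ext laurent_coef (laurent_coef n m) (zbasis K k).
Proof. by rewrite !bilin_ext_zbasis /laurent_coef addrA. Qed.

HB.instance Definition _ := GRing.Zmodule_isComNzRing.Build laurent
  (bilin_extA laurent_coefA : associative laurent_mul)
  (bilin_extC laurent_coefC)
  (bilin_ext1 laurent_coef0) (bilin_extDl laurent_coef) (zbasis_neq0 K 0).

HB.instance Definition _ := GRing.Lmodule_isLalgebra.Build K laurent
  (fun a f g => esym (bilin_extZl laurent_coef a f g)).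

HB.instance Definition _ := GRing.Lalgebra_isComAlgebra.Build K laurent.
End Laurent.

Section EllipticFamily.
Variables (K : fieldType) (e1 e2 : K).

(* The algebra with basis A_n = [zbasis K n] of functions on the cubic
   Y^2 = 4(X - e1)(X - e2)(X + e1 + e2), where A_2k = (X - e1)^k and
   A_(2k+1) = Y (X - e1)^(k-1) / 2. *)
Definition kn_alg : Type := zspace K.

HB.instance Definition _ := GRing.Lmodule.on kn_alg.

Definition kn_coef (n m : int) : zspace K :=
  if (2 %| n)%Z || (2 %| m)%Z then zbasis K (n + m)
  else zbasis K (n + m) + (3 * e1) *: zbasis K (n + m - 2)
       + ((e1 - e2) * (2 * e1 + e2)) *: zbasis K (n + m - 4).

Definition kn_mul (f g : kn_alg) : kn_alg := bilin_ext kn_coef f g.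

Fact kn_coefC n m : kn_coef n m = kn_coef m n.
Proof. by rewrite /kn_coef orbC addrC. Qed.

Fact kn_coef0 n : kn_coef 0 n = zbasis K n.
Proof. by rewrite /kn_coef dvdz0 add0r. Qed.

Fact kn_coef_ev n m : (2 %| n)%Z || (2 %| m)%Z ->
  kn_coef n m = zbasis K (n + m).
Proof. by rewrite /kn_coef => ->. Qed.

Fact kn_coef_odd n m : ~~ (2 %| n)%Z -> ~~ (2 %| m)%Z -> kn_coef n m =
  zbasis K (n + m) + (3 * e1) *: zbasis K (n + m - 2)
  + ((e1 - e2) * (2 * e1 + e2)) *: zbasis K (n + m - 4).
Proof.
by move=> /negPf n_odd /negPf m_odd; rewrite /kn_coef n_odd m_odd.
Qed.

Fact kn_coef_evl n m k : (2 %| n)%Z ->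
  bilin_ext kn_coef (zbasis K n) (kn_coef m k) = kn_coef (n + m) k.
Proof.
move=> n_ev.
have ev j : kn_coef n j = zbasis K (n + j) by rewrite kn_coef_ev ?n_ev.
have [mk_ev|] := boolP ((2 %| m)%Z || (2 %| k)%Z).
  have nmk_ev : (2 %| n + m)%Z || (2 %| k)%Z by lia.
  by rewrite (kn_coef_ev mk_ev) (kn_coef_ev nmk_ev) bilin_ext_zbasis ev addrA.
rewrite negb_or => /andP[m_odd k_odd].
have nm_odd : ~~ (2 %| n + m)%Z by lia.
rewrite (kn_coef_odd m_odd k_odd) (kn_coef_odd nm_odd k_odd).
by rewrite !bilin_extDr !bilin_extZr !bilin_ext_zbasis !ev !addrA.
Qed.

Fact kn_coefA n m k :
  bilin_ext kn_coef (zbasis K n) (kn_coef m k) =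
  bilin_ext kn_coef (kn_coef n m) (zbasis K k).
Proof.
have ev i j : (2 %| i)%Z -> kn_coef i j = zbasis K (i + j).
  by move=> i_ev; rewrite kn_coef_ev ?i_ev.
have evr i j : (2 %| j)%Z -> kn_coef i j = zbasis K (i + j).
  by move=> j_ev; rewrite kn_coef_ev ?j_ev ?orbT.
have [n_ev|n_odd] := boolP (2 %| n)%Z.
  by rewrite (kn_coef_evl _ _ n_ev) (ev _ m n_ev) bilin_ext_zbasis.
have [k_ev|k_odd] := boolP (2 %| k)%Z.
  rewrite (bilin_extC kn_coefC _ (zbasis K k)) (kn_coefC n).
  rewrite (kn_coef_evl _ _ k_ev).
  by rewrite (evr _ _ k_ev) bilin_ext_zbasis kn_coefC (addrC k).
have [m_ev|m_odd] := boolP (2 %| m)%Z.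
  have nm_odd : ~~ (2 %| n + m)%Z by lia.
  have mk_odd : ~~ (2 %| m + k)%Z by lia.
  rewrite (evr _ _ m_ev) (ev _ k m_ev) !bilin_ext_zbasis.
  by rewrite (kn_coef_odd n_odd mk_odd) (kn_coef_odd nm_odd k_odd) !addrA.
have nm_ev : (2 %| n + m)%Z by lia.
have mk_ev : (2 %| m + k)%Z by lia.
have mk2_ev : (2 %| m + k - 2)%Z by lia.
have mk4_ev : (2 %| m + k - 4)%Z by lia.
have nm2_ev : (2 %| n + m - 2)%Z by lia.
have nm4_ev : (2 %| n + m - 4)%Z by lia.
rewrite (kn_coef_odd m_odd k_odd) (kn_coef_odd n_odd m_odd).
rewrite (bilin_extC kn_coefC (zbasis K n)) 4!bilin_extDl 4!bilin_extZl.
rewrite !bilin_ext_zbasis.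
rewrite (ev _ _ mk_ev) (ev _ _ mk2_ev) (ev _ _ mk4_ev).
rewrite (ev _ _ nm_ev) (ev _ _ nm2_ev) (ev _ _ nm4_ev).
have -> : m + k + n = n + m + k by lia.
have -> : m + k - 2 + n = n + m - 2 + k by lia.
by have -> : m + k - 4 + n = n + m - 4 + k by lia.
Qed.

HB.instance Definition _ := GRing.Zmodule_isComNzRing.Build kn_alg
  (bilin_extA kn_coefA : associative kn_mul)
  (bilin_extC kn_coefC)
  (bilin_ext1 kn_coef0) (bilin_extDl kn_coef) (zbasis_neq0 K 0).

HB.instance Definition _ := GRing.Lmodule_isLalgebra.Build K kn_alg
  (fun a f g => esym (bilin_extZl kn_coef a f g)).

HB.instance Definition _ := GRing.Lalgebra_isComAlgebra.Build K kn_alg.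

Lemma kn_mulE n m :
  (zbasis K n : kn_alg) * (zbasis K m : kn_alg) = kn_coef n m.
Proof. exact: bilin_ext_zbasis. Qed.

Definition kn_current (g : finLieAlgType K) : Type := current g kn_alg.

HB.instance Definition _ g := LieAlgebra.on (kn_current g).

Lemma kn_lieE (g : finLieAlgType K) (x y : g) (n m : int) :
  let T z k : kn_current g := tens z (zbasis K k : kn_alg) in
  lie (T x n) (T y m) =
    if (2 %| n)%Z || (2 %| m)%Z then T (lie x y) (n + m)
    else T (lie x y) (n + m) + (3 * e1) *: T (lie x y) (n + m - 2)
         + ((e1 - e2) * (2 * e1 + e2)) *: T (lie x y) (n + m - 4).
Proof.
move=> T; transitivity (tens (lie x y) (kn_coef n m : kn_alg)).
  by rewrite -kn_mulE -lie_tens.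
rewrite /kn_coef; have [nm_ev|nm_odd] := boolP ((2 %| n)%Z || (2 %| m)%Z).
  by [].
by rewrite linearD linearD linearZ linearZ.
Qed.
End EllipticFamily.

Section RiemannSphere.
Variable C : numFieldType.
Implicit Types z w : C.

Definition holomorphic_at (f : C -> C) z : Prop :=
  \forall w \near z, derivable f w 1.

(* [f] is holomorphic in a punctured neighborhood of [z], with at most a pole
   at [z]; its value at [z] is irrelevant. *)
Definition meromorphic_at (f : C -> C) z : Prop :=
  exists n : nat, exists2 h : C -> C, holomorphic_at h z &
    \forall w \near (z^')%classic, (w - z) ^+ n * f w = h w.

(* The projective line, with [None] as the point at infinity. *)
Definition P1 : Type := option C.

HB.instance Definition _ := Choice.on P1.

(* A holomorphic local coordinate t centered at p, given by its inverse. *)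
Definition chart (p : P1) (t : C) : P1 :=
  if p is Some a then Some (a + t) else if t == 0 then None else Some t^-1.

Definition punctured (S : seq P1) : Type := {p : P1 | p \notin S}.

HB.instance Definition _ S := Choice.on (punctured S).

(* The value 0 on S is a dummy: [regular_outside] does not depend on it. *)
Definition extend (S : seq P1) (f : punctured S -> C) (p : P1) : C :=
  if insub p is Some q then f q else 0.

(* [f] is a meromorphic function on the projective line which is holomorphic
   outside S (a meromorphic function is given by its values outside S). *)
Definition regular_outside (S : seq P1) (f : punctured S -> C) : Prop :=
  (forall p, p \notin S -> holomorphic_at (extend f \o chart p) 0) /\
  (forall p, p \in S -> meromorphic_at (extend f \o chart p) 0).

(* The members of [regular_outside S] taking the same value at p and q for
   each pair (p, q) in glue. *)
Definition regular_pred (S : seq P1) (glue : seq (P1 * P1)) :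
    {pred punctured S -> C} :=
  fun f => `[< regular_outside f /\
               forall p q : punctured S,
                 (val p, val q) \in glue -> f p = f q >].

Definition regular_alg (S : seq P1) (glue : seq (P1 * P1)) : Type :=
  {f : punctured S -> C | f \in regular_pred glue}.

Lemma holomorphic_at_cst a z : holomorphic_at (fun=> a) z.
Proof.
near=> w; exact: derivable_cst.
Unshelve. all: by end_near. Qed.

Lemma holomorphic_atD (f g : C -> C) z :
  holomorphic_at f z -> holomorphic_at g z -> holomorphic_at (f \+ g) z.
Proof.
by apply: filterS2 => w; exact: derivableD.
Qed.

Lemma holomorphic_atM (f g : C -> C) z :
  holomorphic_at f z -> holomorphic_at g z -> holomorphic_at (f \* g) z.
Proof.
by apply: filterS2 => w; exact: derivableM.
Qed.

Lemma near_holomorphic (f g : C -> C) z : (\forall w \near z, f w = g w) ->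
  holomorphic_at f z -> holomorphic_at g z.
Proof.
move=> /near_join fg; apply: filterS2 fg => w fg.
exact: near_eq_derivable fg.
Qed.

Lemma holomorphic_at_exp n a z : holomorphic_at (fun w => (w - a) ^+ n) z.
Proof.
elim: n => [|n ih].
  by under [X in holomorphic_at X]eq_fun do rewrite expr0;
     exact: holomorphic_at_cst.
under [X in holomorphic_at X]eq_fun do rewrite exprS.
apply: holomorphic_atM ih; apply: holomorphic_atD.
  by near=> w; exact: derivable_id.
exact: holomorphic_at_cst.
Unshelve. all: by end_near. Qed.

Lemma meromorphic_at_cst a z : meromorphic_at (fun=> a) z.
Proof.
exists 0%N, (fun=> a); first exact: holomorphic_at_cst.
by near=> w; rewrite expr0 mul1r.
Unshelve. all: by end_near. Qed.

Lemma meromorphic_atD (f g : C -> C) z :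
  meromorphic_at f z -> meromorphic_at g z -> meromorphic_at (f \+ g) z.
Proof.
move=> [n [h hh fh]] [m [k hk gk]]; exists (n + m)%N.
exists ((fun w => (w - z) ^+ m) \* h \+ (fun w => (w - z) ^+ n) \* k).
  apply: holomorphic_atD.
    exact: holomorphic_atM (holomorphic_at_exp m z z) hh.
  exact: holomorphic_atM (holomorphic_at_exp n z z) hk.
near=> w; rewrite /= -(near fh w)// -(near gk w)//.
rewrite mulrDr exprD; congr (_ + _);
  by rewrite !mulrA // (mulrC ((w - z) ^+ m)).
Unshelve. all: by end_near. Qed.

Lemma meromorphic_atM (f g : C -> C) z :
  meromorphic_at f z -> meromorphic_at g z -> meromorphic_at (f \* g) z.
Proof.
move=> [n [h hh fh]] [m [k hk gk]]; exists (n + m)%N.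
exists (h \* k); first exact: holomorphic_atM.
near=> w; rewrite /= -(near fh w)// -(near gk w)//.
by rewrite exprD mulrACA.
Unshelve. all: by end_near. Qed.

Section RegularAlgebra.
Variables (S : seq P1) (glue : seq (P1 * P1)).
Implicit Types f g : punctured S -> C.

Lemma extendD f g p : extend (f + g) p = extend f p + extend g p.
Proof. by rewrite /extend; case: insub => //=; rewrite addr0. Qed.

Lemma extendM f g p : extend (f * g) p = extend f p * extend g p.
Proof. by rewrite /extend; case: insub => //=; rewrite mulr0. Qed.

Lemma extendZ a f p : extend (a *: f) p = a * extend f p.
Proof. by rewrite /extend; case: insub => //=; rewrite mulr0. Qed.

Lemma extend1 p : extend (1 : punctured S -> C) p = if p \notin S then 1 else 0.
Proof. by rewrite /extend; case: insubP => [q -> //|/negPf -> //]. Qed.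

Lemma chart_injective p : injective (chart p).
Proof.
case: p => [a|] s t /=; first by case=> /addrI.
case: eqP => [->|_]; case: eqP => [->|_] //.
by case=> /invr_inj.
Qed.

Lemma chart0 p : chart p 0 = p.
Proof. by case: p => [a|]; rewrite /= ?addr0 ?eqxx. Qed.

Lemma near_neq (a b : C) : a != b -> \forall t \near a, t != b.
Proof.
move=> ab; have r0 : 0 < `|a - b| by rewrite normr_gt0 subr_eq0.
apply: filterS (nbhsx_ballx a _ r0) => t.
rewrite -ball_normE /=; apply: contraTneq => ->.
by rewrite ltxx.
Qed.

Lemma near_chart_neq p q : q != p -> \forall t \near (0 : C), chart p t != q.
Proof.
move=> qp; have [[s s_q]|no_s] := pselect (exists s, chart p s = q).
  have s0 : 0 != s by apply: contraNneq qp => s0; rewrite -s_q -s0 chart0.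
  apply: filterS (near_neq s0) => t; rewrite -s_q.
  by rewrite (inj_eq (@chart_injective p)).
by apply: filterE => t; apply/eqP => e; apply: no_s; exists t.
Qed.

Lemma near_chart_notin p : p \notin S ->
  \forall t \near (0 : C), chart p t \notin S.
Proof.
elim: S => [|q r ih]; first by move=> _; exact: filterE.
rewrite inE negb_or eq_sym => /andP[qp pr].
apply: filterS2 (near_chart_neq qp) (ih pr) => t tq tr.
by rewrite inE negb_or tq.
Qed.

Lemma dnear_chart_notin p :
  \forall t \near ((0 : C)^')%classic, chart p t \notin S.
Proof.
elim: S => [|q r ih]; first exact: filterE.
have qP : \forall t \near ((0 : C)^')%classic, chart p t != q.
  have [->|qp] := eqVneq q p; last exact: nbhs_dnbhs (near_chart_neq qp).
  apply: filterS (nbhs_dnbhs_neq (0 : C)) => t t0.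
  by rewrite -[X in _ != X]chart0 (inj_eq (@chart_injective p)).
by apply: filterS2 qP ih => t tq tr; rewrite inE negb_or tq.
Qed.

Lemma regular_outside1 : regular_outside (1 : punctured S -> C).
Proof.
split=> p pS; last first.
  exists 0%N, (fun=> 1); first exact: holomorphic_at_cst.
  apply: filterS (dnear_chart_notin p) => t tS.
  by rewrite expr0 mul1r /= extend1 tS.
apply: near_holomorphic (holomorphic_at_cst 1 0).
by apply: filterS (near_chart_notin pS) => t tS; rewrite /= extend1 tS.
Qed.

Lemma regular_outsideZD a f g : regular_outside f -> regular_outside g ->
  regular_outside (a *: f + g).
Proof.
have E : extend (a *: f + g) = (fun=> a) \* extend f \+ extend g.
  by apply/funext => p; rewrite extendD extendZ.
move=> [hf mf] [hg mg]; split=> p pS.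
  rewrite (_ : _ \o _ =
      (fun=> a) \* (extend f \o chart p) \+ (extend g \o chart p)).
    apply: holomorphic_atD (hg _ pS); apply: holomorphic_atM (hf _ pS).
    exact: holomorphic_at_cst.
  by rewrite E.
rewrite (_ : _ \o _ =
      (fun=> a) \* (extend f \o chart p) \+ (extend g \o chart p)).
  apply: meromorphic_atD (mg _ pS); apply: meromorphic_atM (mf _ pS).
  exact: meromorphic_at_cst.
by rewrite E.
Qed.

Lemma regular_outsideM f g : regular_outside f -> regular_outside g ->
  regular_outside (f * g).
Proof.
have E : extend (f * g) = extend f \* extend g.
  by apply/funext => p; rewrite extendM.
move=> [hf mf] [hg mg]; split=> p pS.
  rewrite (_ : _ \o _ = (extend f \o chart p) \* (extend g \o chart p)).
    exact: holomorphic_atM (hf _ pS) (hg _ pS).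
  by rewrite E.
rewrite (_ : _ \o _ = (extend f \o chart p) \* (extend g \o chart p)).
  exact: meromorphic_atM (mf _ pS) (mg _ pS).
by rewrite E.
Qed.

Local Notation A := (regular_alg S glue).

HB.instance Definition _ := [isSub of A for sval].
HB.instance Definition _ := [Choice of A by <:].

Fact regular_pred_submod : submod_closed (@regular_pred S glue).
Proof.
split=> [|a f g /asboolP[rf gf] /asboolP[rg gg]]; apply/asboolP.
  split=> //; have := regular_outsideZD (-1) regular_outside1 regular_outside1.
  by rewrite scaleN1r addNr.
split=> [|p q pq]; first exact: regular_outsideZD.
by rewrite !fctE (gf _ _ pq) (gg _ _ pq).
Qed.

HB.instance Definition _ := GRing.isSubmodClosed.Build C (punctured S -> C)
  (@regular_pred S glue) regular_pred_submod.

HB.instance Definition _ := [SubChoice_isSubLmodule of A by <:].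

Fact regular_pred1 : 1 \in @regular_pred S glue.
Proof. by apply/asboolP; split=> //; exact: regular_outside1. Qed.

Fact regular_predM f g : f \in @regular_pred S glue ->
  g \in @regular_pred S glue -> f * g \in @regular_pred S glue.
Proof.
move=> /asboolP[rf gf] /asboolP[rg gg]; apply/asboolP.
split=> [|p q pq]; first exact: regular_outsideM.
by rewrite !fctE (gf _ _ pq) (gg _ _ pq).
Qed.

Definition regular_one : A := Sub 1 regular_pred1.
Definition regular_mul (f g : A) : A :=
  Sub (val f * val g) (regular_predM (valP f) (valP g)).

Fact regular_mulA : associative regular_mul.
Proof. by move=> f g h; apply: val_inj; rewrite /= mulrA. Qed.

Fact regular_mulC : commutative regular_mul.
Proof. by move=> f g; apply: val_inj; rewrite /= mulrC. Qed.

Fact regular_mul1 : left_id regular_one regular_mul.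
Proof. by move=> f; apply: val_inj; rewrite /= mul1r. Qed.

Fact regular_mulDl : left_distributive regular_mul +%R.
Proof. by move=> f g h; apply: val_inj; rewrite /= mulrDl. Qed.

Fact punctured_inhabited : exists p : P1, p \notin S.
Proof.
pose s : seq P1 := [seq Some (n%:R : C) | n <- iota 0 (size S).+1].
apply: contrapT => noS.
have us : uniq s.
  rewrite map_inj_uniq ?iota_uniq // => m n [] /eqP.
  by rewrite eqr_nat => /eqP.
have /(uniq_leq_size us) : {subset s <= S}.
  by move=> p _; apply: contrapT => /negP pS; apply: noS; exists p.
by rewrite size_map size_iota ltnn.
Qed.

Fact regular_one_neq0 : regular_one != 0.
Proof.
have [p pS] := punctured_inhabited.
apply/eqP => /(congr1 val) /= /(congr1 (fun f => f (exist _ p pS))) /eqP.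
by rewrite oner_eq0.
Qed.

HB.instance Definition _ := GRing.Zmodule_isComNzRing.Build A
  regular_mulA regular_mulC regular_mul1 regular_mulDl regular_one_neq0.

Fact regular_scalerAl a (f g : A) : a *: (f * g) = (a *: f) * g.
Proof. by apply/val_inj/funext => p; exact: mulrA. Qed.

HB.instance Definition _ := GRing.Lmodule_isLalgebra.Build C A regular_scalerAl.
HB.instance Definition _ := GRing.Lalgebra_isComAlgebra.Build C A.
End RegularAlgebra.

(* The algebras V_(alpha) and W_(alpha). *)
Definition Valg (alpha : C) : Type :=
  regular_alg [:: Some alpha; Some (- alpha); None] [::].

Definition Walg (alpha : C) : Type :=
  regular_alg [:: Some 0; None] [:: (Some alpha, Some (- alpha))].

HB.instance Definition _ alpha := GRing.ComAlgebra.on (Valg alpha).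
HB.instance Definition _ alpha := GRing.ComAlgebra.on (Walg alpha).
End RiemannSphere.

(* Main.v *)
From HB Require Import structures.
Require Import Defs.
From mathcomp Require Import all_boot all_order all_algebra finmap complex.
From mathcomp Require Import boolp classical_sets functions reals.
From mathcomp Require Import topology normedtype landau derive.
From mathcomp Require Import measure lebesgue_measure lebesgue_integral ftc.
From mathcomp Require Import zify ring lra.
From mathcomp Require monalg.

Set Implicit Arguments.
Unset Strict Implicit.
Unset Printing Implicit Defensive.

Import Order.TTheory GRing.Theory Num.Theory numFieldNormedType.Exports.
Local Open Scope ring_scope.

(** Everything happens at the level of commutative algebras: an isomorphism of
    algebras A ~ B induces an isomorphism of the current algebras of g
    ([current_isom]).  Write x = A_2, x' = A_(-2) and y = A_1.  The algebra
    behind the two-parameter family is generated by x, x' and y with the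
    relations x x' = 1 and y^2 = x + 3 e1 + c x', where
    c = (e1 - e2)(2 e1 + e2), so any three elements satisfying these relations
    define a homomorphism out of it ([kn_mapP]).  Such a homomorphism is
    injective as soon as the image of x is transcendental ([kn_injective]):
    up to a power of x, an element of the kernel is P(x) + Q(x) y, the product
    with its conjugate P(x) - Q(x) y gives X P^2 = Q^2 (X^2 + 3 e1 X + c), and
    the degrees of the two sides have different parities.

    The singular cubics are those for which y is a rational function of a
    parameter z on the sphere.
    - For e1 = e2 = 0 the relation is y^2 = x, and A_n corresponds to z^n.
    - For e2 = e1 and for e2 = - 2 e1 one has c = 0, hence x = y^2 - 3 e1: take
      y = mu z and x = mu^2 (z^2 - alpha^2) with mu^2 alpha^2 = 3 e1.  The
      elements x and x' have their zeros and poles in alpha, - alpha and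
      infinity.
    - For e2 = - e1 / 2 the relation reads y^2 = x' (x + 3 e1 / 2)^2: take
      x = mu^2 z^2 and y = mu (z - alpha^2 / z) with
      mu^2 alpha^2 = - 3 e1 / 2.  Then x and y take the same value at alpha
      and - alpha, the two branches of the node.
    Surjectivity is an elementary computation with polynomials once the regular
    functions are known to be rational ([regular_rational]).

    Rationality is the analytic part.  Multiplying by a power of the
    denominator turns a function with poles in a finite set E into a continuous
    function on the plane, complex differentiable outside E and of polynomial
    growth.  Dividing differences (f(z) - f(a)) / (z - a) lowers the growth
    ([growth_divided_difference]) at the cost of one more point where only
    continuity is known, so by induction everything reduces to a Liouville
    theorem ([vanishing_at_infinity]): a continuous function tending to 0 at
    infinity and differentiable outside a finite set E vanishes outside E.
    Suppose that f(a) = 1 after scaling.  Then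
    g(z) = (1 - f(z)) / (z - a) extends to a function of the same kind, so the
    integral of g dz around any square is 0 ([goursat]).  But
    on a large square centered at a the function 1 - f is close to 1, which
    makes the imaginary part of g dz strictly positive along each of the four
    sides.  No value of an integral is needed, so contour integrals are
    replaced by increments of antiderivatives along horizontal and vertical
    lines.  *)

(** * Current algebras and isomorphisms of Lie algebras *)

Lemma lie_sumr (K : nzRingType) (L : lieAlgType K) (x : L) (I : Type)
    (r : seq I) (F : I -> L) :
  lie x (\sum_(i <- r) F i) = \sum_(i <- r) lie x (F i).
Proof. exact: linear_sum. Qed.

Section CurrentFunctor.
Variables (K : fieldType) (g : finLieAlgType K) (A B : comAlgType K).

(** The map is applied coordinatewise in a basis of g; the bracket is compared
    on pure tensors, which suffices by bilinearity. *)
Lemma current_isom (psi : {lrmorphism A -> B}) :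
  bijective psi -> lie_isom (current g A) (current g B).
Proof.
move=> [psi' psiK psi'K].
pose phi (u : current g A) : current g B := [ffun i => psi (u i)].
have phi_lin : linear phi.
  by move=> a u v; apply/ffunP => i; rewrite !ffunE linearP.
pose Phi : {linear current g A -> current g B} :=
  HB.pack phi
    (GRing.isLinear.Build K (current g A) (current g B) *:%R phi phi_lin).
exists Phi; split.
  exists (fun v : current g B => [ffun i => psi' (v i)] : current g A) => u;
    by apply/ffunP => i; rewrite !ffunE ?psiK ?psi'K.
have tensE x f : Phi (tens x f) = tens x (psi f).
  by apply/ffunP => i; rewrite !ffunE linearZ.
move=> u v; rewrite [u]tensorE [v]tensorE.
rewrite lie_suml !(linear_sum Phi) lie_suml; apply: eq_bigr => i _.
rewrite !lie_sumr (linear_sum Phi); apply: eq_bigr => j _.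
by rewrite lie_tens !tensE lie_tens rmorphM.
Qed.

End CurrentFunctor.

Section LieIsom.
Variable K : nzRingType.

Lemma lie_isom_sym (L1 L2 : lieAlgType K) : lie_isom L1 L2 -> lie_isom L2 L1.
Proof.
move=> [phi [[psi phiK psiK] phiL]].
have psi_lin : linear psi.
  by move=> a u v; apply: (can_inj phiK); rewrite linearP !psiK.
pose Psi : {linear L2 -> L1} :=
  HB.pack psi (GRing.isLinear.Build K L2 L1 *:%R psi psi_lin).
exists Psi; split; first by exists phi.
by move=> u v; apply: (can_inj phiK); rewrite phiL !psiK.
Qed.

Lemma lie_isom_trans (L1 L2 L3 : lieAlgType K) :
  lie_isom L1 L2 -> lie_isom L2 L3 -> lie_isom L1 L3.
Proof.
move=> [phi [phi_bij phiL]] [psi [psi_bij psiL]].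
exists (psi \o phi : {linear _ -> _}); split; first exact: bij_comp.
by move=> u v; rewrite /= phiL psiL.
Qed.
End LieIsom.

Section ZspaceExtension.
Variables (K : fieldType) (V : lmodType K) (F : int -> V).

Definition zspace_ext (f : zspace K) : V :=
  \sum_(n <- monalg.msupp f) monalg.mcoeff n f *: F n.

HB.instance Definition _ :=
  GRing.isLinear.Build K (zspace K) V *:%R zspace_ext (zsum_linear F).

Lemma zspace_ext_zbasis n : zspace_ext (zbasis K n) = F n.
Proof.
rewrite /zspace_ext monalg.msuppU oner_eq0 finmap.big_seq_fset1.
by rewrite monalg.mcoeffU eqxx scale1r.
Qed.
End ZspaceExtension.

Section KnAlgebra.
Variables (K : fieldType) (e1 e2 : K).

(** The carrier [kn_alg K] does not mention e1 and e2, which therefore cannot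
    be inferred from it; this bundles the algebra structure they determine. *)
Definition kn_comAlg : comAlgType K :=
  Defs_kn_alg__canonical__GRing_ComAlgebra e1 e2.

Definition knA (n : int) : kn_comAlg := zbasis K n.

Lemma knAM n m : knA n * knA m = kn_coef e1 e2 n m.
Proof. exact: kn_mulE. Qed.

Lemma knA_evM n m : (2 %| n)%Z -> knA n * knA m = knA (n + m).
Proof. by move=> n_ev; rewrite knAM kn_coef_ev ?n_ev. Qed.

Lemma kn_ind (P : kn_comAlg -> Prop) :
    P 0 -> (forall a n f, P f -> P (a *: knA n + f)) -> forall f, P f.
Proof. exact: zspace_ind. Qed.

End KnAlgebra.

Section KnHom.
Variables (K : fieldType) (e1 e2 : K) (B : comAlgType K).
Local Notation c2 := ((e1 - e2) * (2 * e1 + e2)).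

(** The powers x^n for n an integer, where x' stands for the inverse of x in a
    ring that need not have an inverse operation. *)
Definition zpow (x x' : B) (n : int) : B :=
  if n is Negz k then x' ^+ k.+1 else x ^+ `|n|%N.

Lemma zpowB (x x' : B) (m n : nat) : x * x' = 1 ->
  zpow x x' (m%:Z - n%:Z) = x ^+ m * x' ^+ n.
Proof.
move=> xx'; case: (leqP n m) => [le_nm|lt_mn].
  rewrite subzn // /zpow absz_nat -{2}(subnK le_nm) exprD -mulrA.
  by rewrite -exprMn xx' expr1n mulr1.
have -> : m%:Z - n%:Z = Negz (n - m).-1 by lia.
rewrite /zpow prednK ?subn_gt0 //.
rewrite -{2}(subnKC (ltnW lt_mn)) exprD mulrA.
by rewrite -exprMn xx' expr1n mul1r.
Qed.

Lemma zpowD (x x' : B) (m n : int) : x * x' = 1 ->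
  zpow x x' (m + n) = zpow x x' m * zpow x x' n.
Proof.
move=> xx'; have intB (k : int) : exists a b : nat, k = a%:Z - b%:Z.
  by case: k => k; [exists k, 0%N | exists 0%N, k.+1]; lia.
have [a [b ->]] := intB m; have [c [d ->]] := intB n.
have -> : a%:Z - b%:Z + (c%:Z - d%:Z) = (a + c)%N%:Z - (b + d)%N%:Z by lia.
by rewrite !zpowB // !exprD mulrACA.
Qed.

Variables x x' y : B.
Hypothesis xx' : x * x' = 1.
Hypothesis yy : y * y = x + (3 * e1) *: 1 + c2 *: x'.

(** The image of A_n, as A_(2k) = x^k and A_(2k+1) = x^k y. *)
Definition kn_gen (n : int) : B :=
  zpow x x' (n %/ 2)%Z * (if (2 %| n)%Z then 1 else y).

Definition kn_map : kn_comAlg e1 e2 -> B := zspace_ext kn_gen.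

Lemma kn_map_linear : linear kn_map.
Proof. exact: linearP. Qed.

Lemma kn_map_zbasis n : kn_map (zbasis K n) = kn_gen n.
Proof. exact: zspace_ext_zbasis. Qed.

HB.instance Definition _ :=
  GRing.isLinear.Build K (kn_comAlg e1 e2) B *:%R kn_map kn_map_linear.

Lemma kn_genM n m : kn_gen n * kn_gen m = kn_map (kn_coef e1 e2 n m).
Proof.
rewrite /kn_coef; case: ifPn => [nm_ev|].
  have dE : ((n + m) %/ 2)%Z = (n %/ 2)%Z + (m %/ 2)%Z by lia.
  rewrite kn_map_zbasis /kn_gen dE zpowD // -!mulrA; congr (_ * _).
  case: (boolP (2 %| n)%Z) nm_ev => [n_ev _|n_odd /= m_ev].
    by rewrite mul1r; have -> : (2 %| n + m)%Z = (2 %| m)%Z by lia.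
  have -> : (2 %| n + m)%Z = false by lia.
  by rewrite m_ev mulr1 mulrC.
rewrite negb_or => /andP[n_odd m_odd].
rewrite !linearD !linearZ /= !kn_map_zbasis.
rewrite /kn_gen (negPf n_odd) (negPf m_odd) mulrACA yy -zpowD //.
set k := (_ + _)%Z.
have d1 : ((n + m) %/ 2)%Z = k + 1 by rewrite /k; lia.
have d2 : ((n + m - 2) %/ 2)%Z = k by rewrite /k; lia.
have d3 : ((n + m - 4) %/ 2)%Z = k - 1 by rewrite /k; lia.
have [-> -> ->] : [/\ (2 %| n + m)%Z, (2 %| n + m - 2)%Z & (2 %| n + m - 4)%Z].
  by split; lia.
rewrite d1 d2 d3 !mulr1 !zpowD // !mulrDr -!scalerAr mulr1.
by congr (_ + _ + _ *: (_ * _)); rewrite /zpow /= expr1.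
Qed.

Lemma kn_map_monoid : monoid_morphism kn_map.
Proof.
split; first by rewrite [LHS]kn_map_zbasis /kn_gen /= expr0 mulr1.
have M1 n f : kn_map (knA e1 e2 n * f) = kn_gen n * kn_map f.
  elim/kn_ind: f => [|a m f ih].
    by rewrite mulr0 !linear0 mulr0.
  rewrite mulrDr !linearD /= ih mulrDr -scalerAr !linearZ /= knAM -kn_genM.
  by rewrite kn_map_zbasis scalerAr.
move=> f h; elim/kn_ind: f => [|a n f ih].
  by rewrite mul0r !linear0 mul0r.
rewrite mulrDl !linearD /= ih mulrDl -scalerAl !linearZ /= M1.
by rewrite kn_map_zbasis scalerAl.
Qed.

HB.instance Definition _ :=
  GRing.isMonoidMorphism.Build (kn_comAlg e1 e2) B kn_map kn_map_monoid.

(** The universal property of the algebra of the family: x, x' and y generate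
    it, with no relations but the two assumed here. *)
Lemma kn_mapP : {phi : {lrmorphism kn_comAlg e1 e2 -> B} |
  [/\ phi (knA e1 e2 2) = x, phi (knA e1 e2 (- 2)) = x' &
      phi (knA e1 e2 1) = y]}.
Proof.
exists kn_map; split; rewrite [LHS]kn_map_zbasis /kn_gen /= ?expr1 ?mulr1 //.
by rewrite expr0 mul1r.
Qed.
End KnHom.

(** * Injectivity of homomorphisms from the cubic algebra *)

Lemma lrmorph_horner_alg (K : fieldType) (A B : comAlgType K)
    (phi : {lrmorphism A -> B}) a p :
  phi (horner_alg a p) = horner_alg (phi a) p.
Proof.
rewrite /horner_alg /horner_morph -horner_map -map_poly_comp /=.
by congr (_.[_]); apply: eq_map_poly => c; rewrite /= linearZ rmorph1.
Qed.

Section KnInjective.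
Variables (K : fieldType) (e1 e2 : K).
Local Notation c2 := ((e1 - e2) * (2 * e1 + e2)).
Local Notation A := (knA e1 e2).

Lemma knA_even (k : nat) : A (2 * k) = A 2 ^+ k.
Proof.
elim: k => [|k ih]; first by rewrite expr0.
rewrite exprS -ih knA_evM //; congr (A _); lia.
Qed.

Lemma knA_nat (m : nat) :
  A m = A 2 ^+ m./2 * (if odd m then A 1 else 1).
Proof.
rewrite -knA_even; case: ifPn => m_odd.
  by rewrite knA_evM; [congr (A _) | ]; lia.
by rewrite mulr1; congr (A _); lia.
Qed.

(** A power of x removes the negative indices; the even ones then contribute
    to p and the odd ones to q. *)
Lemma kn_normal_form (f : kn_comAlg e1 e2) : exists (k : nat) (p q : {poly K}),
  f * A 2 ^+ k = horner_alg (A 2) p + horner_alg (A 2) q * A 1.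
Proof.
elim/kn_ind: f => [|a n f [k [p [q fE]]]].
  by exists 0%N, 0, 0; rewrite !rmorph0 !mul0r addr0.
(* k + |n| is an exponent large enough for both summands. *)
pose d := `|n|%N; pose m := absz (n + (d + d + 2 * k)%N).
have nE : A n * A 2 ^+ (k + d) = A m.
  rewrite mulrC -knA_even knA_evM; last by lia.
  by congr (A _); lia.
pose r b : {poly K} := if odd m == b then a *: 'X^(m./2) else 0.
exists (k + d)%N, (p * 'X^d + r false), (q * 'X^d + r true).
rewrite mulrDl -scalerAl nE exprD mulrA fE knA_nat.
rewrite !rmorphD !rmorphM !rmorphXn /= !horner_algX /r.
case: (odd m); rewrite /= linearZ /= !rmorph0 rmorphXn /= horner_algX.
  by rewrite scalerAl mulr_algl; ring.
by rewrite mulr1 mulr_algl; ring.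
Qed.

(** If p and q were nonzero, the left-hand side would have odd degree and the
    right-hand side even degree. *)
Lemma kn_norm_eq0 (p q : {poly K}) :
  'X * p ^+ 2 = q ^+ 2 * ('X^2 + (3 * e1) *: 'X + c2%:P) -> p = 0 /\ q = 0.
Proof.
set r := (_ + _ + _) => pqE.
have sr : size r = 3.
  rewrite /r -addrA size_polyDl ?size_polyXn //.
  rewrite (leq_ltn_trans (size_polyD _ _)) // gtn_max.
  rewrite (leq_ltn_trans (size_scale_leq _ _)) ?size_polyX //.
  by rewrite (leq_ltn_trans (size_polyC_leq1 _)).
have r0 : r != 0 by rewrite -size_poly_gt0 sr.
have [p0|p0] := eqVneq p 0.
  split=> //; move/eqP: pqE.
  by rewrite p0 expr0n mulr0 eq_sym mulf_eq0 (negPf r0) orbF expf_eq0 => /eqP.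
have [q0|q0] := eqVneq q 0.
  split=> //; move/eqP: pqE.
  by rewrite q0 expr0n mul0r mulf_eq0 polyX_eq0 expf_eq0 => /eqP.
have := congr1 (fun u : {poly K} => size u) pqE.
rewrite /= !expr2 !size_mul ?mulf_neq0 ?polyX_eq0 // size_polyX sr.
have : (0 < size p)%N by rewrite size_poly_gt0.
have : (0 < size q)%N by rewrite size_poly_gt0.
move: (size p) (size q) => a b; rewrite -[2%R]/2%N -[3%R]/3%N; lia.
Qed.

Variables (B : comAlgType K) (phi : {lrmorphism kn_comAlg e1 e2 -> B}).

(** If p(x) + q(x) y is in the kernel, so is x times its norm p(x)^2 - q(x)^2
    y^2, which is a polynomial in x and hence the zero polynomial. *)
Lemma kn_injective :
  (forall p, horner_alg (phi (A 2)) p = 0 -> p = 0) -> injective phi.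
Proof.
move=> phi_tr; apply: raddf_inj => f f0.
have [k [p [q fE]]] := kn_normal_form f.
have [p0 q0] : p = 0 /\ q = 0.
  apply: kn_norm_eq0; apply/eqP; rewrite -subr_eq0; apply/eqP/phi_tr.
  have := congr1 phi fE; rewrite rmorphM f0 mul0r rmorphD rmorphM /=.
  rewrite !lrmorph_horner_alg => /esym.
  have yy : phi (A 2) * phi (A 1) ^+ 2 =
      phi (A 2) ^+ 2 + (3 * e1) *: phi (A 2) + c2%:A.
    rewrite -!rmorphXn -[in RHS](rmorph1 phi) -!linearZ -!rmorphM -!linearD.
    congr (phi _); rewrite !expr2 knAM.
    have -> : kn_coef e1 e2 1 1 = A 2 + (3 * e1) *: A 0 + c2 *: A (- 2) by [].
    rewrite !mulrDr -!scalerAr !knA_evM //.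
  move: c2 yy => c yy; rewrite !expr2 rmorphB !rmorphM /= !rmorphD /=.
  rewrite linearZ rmorphM /=.
  rewrite horner_algX horner_algC mulr_algl -expr2 -yy => pq0.
  set P := horner_alg _ p in pq0 *; set Q := horner_alg _ q in pq0 *.
  set X := phi (A 2); set Y := phi (A 1) in pq0 *.
  have -> : X * P ^+ 2 - Q ^+ 2 * (X * Y ^+ 2) = X * (P - Q * Y) * (P + Q * Y).
    ring.
  by rewrite pq0 mulr0.
have A2V : A 2 ^+ k * A (- 2) ^+ k = 1 by rewrite -exprMn knA_evM // expr1n.
by rewrite -[f]mulr1 -A2V mulrA fE p0 q0 !rmorph0 mul0r addr0 mul0r.
Qed.
End KnInjective.

(** * Subdivision of squares *)

Section Cousin.
Variable R : realType.

(** The supremum of the left ends lies in every segment. *)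
Lemma nested_segments (a s : nat -> R) :
    (forall n, a n <= a n.+1) -> (forall n, a n.+1 + s n.+1 <= a n + s n) ->
    (forall n, 0 <= s n) ->
  exists x, forall n, a n <= x <= a n + s n.
Proof.
move=> a_up b_down s0.
have aM n m : (n <= m)%N -> a n <= a m.
  exact: (@homo_leq _ _ <=%O (@lexx _ _) (@le_trans _ _) a_up).
have bM n m : (n <= m)%N -> a m + s m <= a n + s n.
  exact: (@homo_leq _ (fun n => a n + s n) (fun x y => y <= x)
            (@lexx _ _) (fun y x z xy yz => le_trans yz xy) b_down).
have ab n m : a n <= a m + s m.
  case: (leqP n m) => [nm|/ltnW mn].
    by rewrite (le_trans (aM _ _ nm)) // lerDl.
  by rewrite (le_trans _ (bM _ _ mn)) // lerDl.
exists (sup (range a)) => n; apply/andP; split.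
  apply: ub_le_sup; last by exists n.
  by exists (a 0%N + s 0%N) => _ [m _ <-].
apply: ge_sup; first by exists (a 0%N); exists 0%N.
by move=> _ [m _ <-].
Qed.

(** Quartering a bad square repeatedly yields shrinking bad squares around a
    common point, near which small squares are good. *)
Lemma cousin_square (good : R -> R -> R -> Prop) :
    (forall a c s, 0 < s -> good a c s -> good (a + s) c s ->
       good a (c + s) s -> good (a + s) (c + s) s -> good a c (2 * s)) ->
    (forall x y, exists2 d, 0 < d & forall a c s, 0 < s < d ->
       a <= x <= a + s -> c <= y <= c + s -> good a c s) ->
  forall a c s, 0 < s -> good a c s.
Proof.
move=> good4 good_loc a0 c0 s0 s0_gt0; apply: contrapT => bad0.
pose bad (q : R * R * R) := ~ good q.1.1 q.1.2 q.2.
have step q : 0 < q.2 -> bad q -> exists q', [/\ bad q', q'.2 = q.2 / 2,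
    q.1.1 <= q'.1.1 <= q.1.1 + q.2 / 2 & q.1.2 <= q'.1.2 <= q.1.2 + q.2 / 2].
  case: q => [[a c] s] /= s_gt0 bq; apply: contrapT => no_q.
  have goodH a' c' : a <= a' <= a + s / 2 -> c <= c' <= c + s / 2 ->
      good a' c' (s / 2).
    by move=> aP cP; apply: contrapT => b; apply: no_q; exists (a', c', s / 2).
  have s2 : 0 < s / 2 by lra.
  apply: bq => /=; have -> : s = 2 * (s / 2) by lra.
  by apply: good4 => //; apply: goodH; lra.
have /choice[f fP] : forall q, exists q', 0 < q.2 -> bad q ->
    [/\ bad q', q'.2 = q.2 / 2, q.1.1 <= q'.1.1 <= q.1.1 + q.2 / 2 &
        q.1.2 <= q'.1.2 <= q.1.2 + q.2 / 2].
  move=> q; have [[q0 bq]|nq] := pselect (0 < q.2 /\ bad q).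
    by have [q' q'P] := step q q0 bq; exists q'.
  by exists q => q0 bq; case: nq.
pose u n := iter n f (a0, c0, s0).
have uP n : bad (u n) /\ (u n).2 = s0 / 2 ^+ n.
  elim: n => [|n [bu su]]; first by rewrite expr0 divr1.
  have u0 : 0 < (u n).2 by rewrite su divr_gt0 // exprn_gt0.
  have [bu' su' _ _] := fP _ u0 bu; split=> //.
  by rewrite [LHS]su' su exprSr invfM mulrA.
have u_gt0 n : 0 < (u n).2 by rewrite (uP n).2 divr_gt0 // exprn_gt0.
have uS n := fP _ (u_gt0 n) (uP n).1.
have [x xP] : exists x, forall n, (u n).1.1 <= x <= (u n).1.1 + (u n).2.
  apply: nested_segments => n; last exact: ltW.
    by have [_ _ /andP[]] := uS n.
  by have [_ su /andP[_ aP] _] := uS n; rewrite /= -/(u n) su; move: aP; lra.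
have [y yP] : exists y, forall n, (u n).1.2 <= y <= (u n).1.2 + (u n).2.
  apply: nested_segments => n; last exact: ltW.
    by have [_ _ _ /andP[]] := uS n.
  by have [_ su _ /andP[_ aP]] := uS n; rewrite /= -/(u n) su; move: aP; lra.
have [d d0 good_d] := good_loc x y.
have [n sn] : exists n, s0 / 2 ^+ n < d.
  have [n nP] : exists n : nat, s0 / d < n%:R.
    by exists (Num.truncn (s0 / d)).+1; exact: truncnS_gt.
  exists n; rewrite ltr_pdivrMr ?exprn_gt0 //.
  rewrite -ltr_pdivrMl // mulrC (lt_trans nP) //.
  by rewrite -natrX ltr_nat ltn_expl.
apply: (uP n).1; apply: good_d => //.
by rewrite u_gt0 (uP n).2.
Qed.
End Cousin.

(** * The Goursat theorem for differentiable closed forms *)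

Section Circulation.
Variable R : realType.
Implicit Types (P Q H V : R -> R -> R) (E : seq (R * R)).
Implicit Types (a b c d s e x y z K : R).

Lemma MVT_everywhere (f df : R -> R) a b : a <= b ->
  (forall x, is_derive x 1 f (df x)) ->
  exists2 z, a <= z <= b & f b - f a = df z * (b - a).
Proof.
move=> ab dfP.
have [|z zab fE] := @MVT_segment R f df a b ab (fun x _ => dfP x).
  by apply: derivable_within_continuous => x _; have [] := dfP x.
by exists z => //; rewrite in_itv in zab.
Qed.

Lemma mean_value_le (f df : R -> R) a b K : a <= b ->
  (forall x, is_derive x 1 f (df x)) ->
  (forall x, a <= x <= b -> `|df x| <= K) ->
  `|f b - f a| <= K * (b - a).
Proof.
move=> ab dfP dfK; have [z zab ->] := MVT_everywhere ab dfP.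
rewrite normrM (ger0_norm (_ : 0 <= b - a)) ?subr_ge0 //.
by rewrite ler_wpM2r ?subr_ge0 ?dfK.
Qed.

(** When H(., y) and V(x, .) are antiderivatives of P(., y) and Q(x, .), this
    is the integral of P dx + Q dy around the rectangle [a, b] x [c, d]. *)
Definition circulation (H V : R -> R -> R) a b c d :=
  (H b c - H a c) - (H b d - H a d) + (V b d - V b c) - (V a d - V a c).

Lemma circulation_le H V P Q K a c s : 0 <= s ->
    (forall x y, is_derive x 1 (H^~ y) (P x y)) ->
    (forall x y, is_derive y 1 (V x) (Q x y)) ->
    (forall x y, a <= x <= a + s -> c <= y <= c + s ->
       `|P x y| <= K /\ `|Q x y| <= K) ->
  `|circulation H V a (a + s) c (c + s)| <= 4 * K * s.
Proof.
move=> s0 dH dV PQ.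
have as0 : a <= a + s by rewrite lerDl.
have cs0 : c <= c + s by rewrite lerDl.
have hH y : c <= y <= c + s -> `|H (a + s) y - H a y| <= K * s.
  move=> yP; rewrite (_ : K * s = K * (a + s - a)); last by ring.
  apply: mean_value_le (fun x => dH x y) _ => // x xP.
  by have [] := PQ x y xP yP.
have hV x : a <= x <= a + s -> `|V x (c + s) - V x c| <= K * s.
  move=> xP; rewrite (_ : K * s = K * (c + s - c)); last by ring.
  by apply: mean_value_le (dV x) _ => // y yP; have [] := PQ x y xP yP.
have ca : a <= a <= a + s by rewrite lexx.
have cb : a <= a + s <= a + s by rewrite lexx andbT.
have cc : c <= c <= c + s by rewrite lexx.
have cd : c <= c + s <= c + s by rewrite lexx andbT.
move: (hH _ cc) (hH _ cd) (hV _ ca) (hV _ cb).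
rewrite /circulation !ler_norml; lra.
Qed.

(** Differentiability of the form P dx + Q dy at (x0, y0), together with the
    equality of the cross derivatives P_y = Q_x = [be] which makes the first
    order part of the form exact. *)
Definition closed_at P Q x0 y0 := exists al be ga : R, forall e, 0 < e ->
  exists2 d, 0 < d & forall x y, `|x - x0| < d -> `|y - y0| < d ->
    `|P x y - (P x0 y0 + al * (x - x0) + be * (y - y0))| <=
       e * (`|x - x0| + `|y - y0|) /\
    `|Q x y - (Q x0 y0 + be * (x - x0) + ga * (y - y0))| <=
       e * (`|x - x0| + `|y - y0|).

Definition bounded_at P Q x0 y0 := exists K, exists2 d, 0 < d &
  forall x y, `|x - x0| < d -> `|y - y0| < d -> `|P x y| <= K /\ `|Q x y| <= K.

(** The first order part of the form at (x0, y0) has explicit antiderivatives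
    and no circulation, so only the remainder counts; it is o(s), and so its
    integral over a contour of length 4 s is o(s^2). *)
Lemma circulation_local P Q H V x0 y0 :
    (forall x y, is_derive x 1 (H^~ y) (P x y)) ->
    (forall x y, is_derive y 1 (V x) (Q x y)) ->
    closed_at P Q x0 y0 ->
  forall e, 0 < e -> exists2 d, 0 < d & forall a c s, 0 < s < d ->
    a <= x0 <= a + s -> c <= y0 <= c + s ->
  `|circulation H V a (a + s) c (c + s)| <= e * s ^+ 2.
Proof.
move=> dH dV [al [be [ga PQ]]] e e0.
have [|d d0 PQd] := PQ (e / 8); first by lra.
exists d => // a c s /andP[s0 sd] aP cP.
pose P1 x y := P x0 y0 + al * (x - x0) + be * (y - y0).
pose Q1 x y := Q x0 y0 + be * (x - x0) + ga * (y - y0).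
pose H1 x y := (P x0 y0 + be * (y - y0)) * x + al / 2 * (x - x0) ^+ 2.
pose V1 x y := (Q x0 y0 + be * (x - x0)) * y + ga / 2 * (y - y0) ^+ 2.
have -> : circulation H V a (a + s) c (c + s) =
    circulation (fun x y => H x y - H1 x y) (fun x y => V x y - V1 x y)
      a (a + s) c (c + s).
  by rewrite /circulation /H1 /V1; ring.
have -> : e * s ^+ 2 = 4 * (e / 8 * (s + s)) * s by field.
apply: (@circulation_le _ _ (fun x y => P x y - P1 x y)
                            (fun x y => Q x y - Q1 x y)).
- exact: ltW.
- move=> x y; apply: is_deriveB; apply: is_derive_eq.
  by rewrite /P1 /= /GRing.scale /=; field.
- move=> x y; apply: is_deriveB; apply: is_derive_eq.
  by rewrite /Q1 /= /GRing.scale /=; field.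
move=> x y xP yP.
have xs : `|x - x0| <= s by rewrite ler_norml; lra.
have ys : `|y - y0| <= s by rewrite ler_norml; lra.
have [h1 h2] := PQd x y (le_lt_trans xs sd) (le_lt_trans ys sd).
have es : e / 8 * (`|x - x0| + `|y - y0|) <= e / 8 * (s + s).
  by rewrite ler_wpM2l ?lerD //; lra.
by split; [exact: le_trans h1 es | exact: le_trans h2 es].
Qed.

Lemma sgr_homo (x y : R) : x <= y -> Num.sg x <= Num.sg y.
Proof. by move=> xy; case: (sgrP x); case: (sgrP y); lra. Qed.

Lemma sgr_jump (x y : R) : x < y -> x <= 0 <= y -> 1 <= Num.sg y - Num.sg x.
Proof. by move=> xy xy0; case: (sgrP x); case: (sgrP y); lra. Qed.

(** A square of side s is called good when its circulation is at most e times
    its mass. The mass is additive and consists of the area, which dominates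
    the o(s^2) at the ordinary points, and of an atom at each point of E,
    which dominates the O(s) there. *)
Lemma goursat P Q H V E a c s :
    (forall x y, is_derive x 1 (H^~ y) (P x y)) ->
    (forall x y, is_derive y 1 (V x) (Q x y)) ->
    (forall x y, (x, y) \notin E -> closed_at P Q x y) ->
    (forall x y, (x, y) \in E -> bounded_at P Q x y) ->
  0 < s -> circulation H V a (a + s) c (c + s) = 0.
Proof.
move=> dH dV cPQ bPQ s0.
(* The atom is a product of increments of sign functions: such a product is
   additive, and it is at least 1 on a square containing p even when p lies on
   the boundary. *)
pose jump (p : R * R) a c s :=
  (Num.sg (a + s - p.1) - Num.sg (a - p.1)) *
  (Num.sg (c + s - p.2) - Num.sg (c - p.2)).
pose mass a c s := s ^+ 2 + \sum_(p <- E) jump p a c s.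
have jump0 p a' c' s' : 0 < s' -> 0 <= jump p a' c' s'.
  by move=> s'0; apply: mulr_ge0; rewrite subr_ge0 sgr_homo; lra.
have mass_gt a' c' s' : 0 < s' -> s' ^+ 2 <= mass a' c' s'.
  by move=> s'0; rewrite lerDl sumr_ge0 // => p _; exact: jump0.
have massE a' c' s' : mass a' c' (2 * s') =
    mass a' c' s' + mass (a' + s') c' s' + mass a' (c' + s') s' +
    mass (a' + s') (c' + s') s'.
  have jumpE p : jump p a' c' (2 * s') =
      jump p a' c' s' + jump p (a' + s') c' s' + jump p a' (c' + s') s' +
      jump p (a' + s') (c' + s') s'.
    rewrite /jump (_ : a' + 2 * s' = a' + s' + s'); last by ring.
    by rewrite (_ : c' + 2 * s' = c' + s' + s'); [ring | ring].
  rewrite /mass; under eq_bigr do rewrite jumpE.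
  by rewrite !big_split /=; ring.
suff small e : 0 < e ->
    `|circulation H V a (a + s) c (c + s)| <= e * mass a c s.
  apply/eqP; rewrite -normr_le0; apply: contrapT => /negP; rewrite -ltNge => N0.
  have m0 : 0 < mass a c s.
    by apply: lt_le_trans (mass_gt _ _ _ s0); rewrite exprn_gt0.
  have := small _ (divr_gt0 N0 (mulr_gt0 (ltr0Sn R 1) m0)).
  rewrite (_ : _ / _ * _ = `|circulation H V a (a + s) c (c + s)| / 2).
    by lra.
  by field; exact: lt0r_neq0.
move=> e0; apply: (@cousin_square R (fun a c s =>
  `|circulation H V a (a + s) c (c + s)| <= e * mass a c s)) => // {a c s s0}.
  move=> a c s s0; rewrite massE.
  rewrite (_ : a + 2 * s = a + s + s); last by ring.
  rewrite (_ : c + 2 * s = c + s + s); last by ring.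
  set a' := a + s; set c' := c + s => g1 g2 g3 g4.
  have -> : circulation H V a (a' + s) c (c' + s) =
      circulation H V a a' c c' + circulation H V a' (a' + s) c c' +
      circulation H V a a' c' (c' + s) +
      circulation H V a' (a' + s) c' (c' + s).
    by rewrite /circulation; ring.
  rewrite 3!mulrDr; do 3!(apply: le_trans (ler_normD _ _) _; apply: lerD => //).
move=> x y; have [xyE|xyE] := boolP ((x, y) \in E); last first.
  have [d d0 dP] := circulation_local dH dV (cPQ _ _ xyE) e0.
  exists d => // a c s sd aP cP; apply: le_trans (dP _ _ _ sd aP cP) _.
  by rewrite ler_wpM2l ?(ltW e0) ?mass_gt //; move/andP: sd => [].
have [K [d d0 dP]] := bPQ _ _ xyE.
(* The circulation is at most 4 (|K| + 1) s, and e times the mass at least e. *)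
exists (Num.min d (e / (4 * (`|K| + 1)))).
  by rewrite lt_min d0 divr_gt0 // mulr_gt0 // ltr_pwDr.
move=> a c s; rewrite lt_min => /and3P[s0 sd sK] aP cP.
have mass1 : 1 <= mass a c s.
  have j1 : 1 <= jump (x, y) a c s.
    by rewrite -[leLHS]mulr1 ler_pM // sgr_jump /=; lra.
  rewrite /mass (big_rem _ xyE) /= addrCA (le_trans j1) // lerDl.
  by rewrite addr_ge0 ?sqr_ge0 // sumr_ge0 // => p _; exact: jump0.
apply: le_trans (_ : 4 * (`|K| + 1) * s <= _).
  apply: circulation_le dH dV _ => //; first exact: ltW.
  move=> x1 y1 xP yP; have [] := dP x1 y1.
  - by rewrite ltr_norml; lra.
  - by rewrite ltr_norml; lra.
  - by move: (ler_norm K) => KK h1 h2; split; lra.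
have K0 : 0 < 4 * (`|K| + 1) by rewrite mulr_gt0 // ltr_pwDr.
move: sK; rewrite ltr_pdivlMr // mulrC => /ltW /le_trans; apply.
by rewrite ler_peMr // ltW.
Qed.
End Circulation.

(** * Antiderivatives of continuous functions *)

Section Antiderivative.
Variable R : realType.
Implicit Types (x y : R).

(** The integral from -m provides an antiderivative on ]-m, +oo[ only; those
    for different m differ by constants, and normalizing them at 0 glues them
    into one defined on the whole line. *)
Lemma continuous_antiderivative (f : R -> R) : continuous f ->
  exists F : R -> R, forall x, is_derive x 1 F (f x).
Proof.
move=> cf.
pose F (m x : R) := (\int[lebesgue_measure]_(t in `[- m, x]) f t)%R.
have dF m x : - m < x -> is_derive x 1 (F m) (f x).
  move=> mx; have [] := @continuous_FTC1_closed R f (- m) x (x + 1).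
  - by rewrite ltrDl.
  - apply: continuous_compact_integrable; first exact: segment_compact.
    exact: continuous_subspaceT.
  - exact: mx.
  - exact: cf.
  by move=> dFx Fx; apply: (DeriveDef dFx); rewrite -derive1E.
pose G x := F (`|x| + 1) x - F (`|x| + 1) 0.
have GE m x : `|x| < m -> G x = F m x - F m 0.
  move=> xm; pose k := Num.min m (`|x| + 1).
  have xk : `|x| < k by rewrite lt_min xm ltrDl /=.
  have dk y : - k < y -> is_derive y 1 (F (`|x| + 1) \- F m) 0.
    rewrite /k => yk; have [y1 y2] : - (`|x| + 1) < y /\ - m < y.
      by move: yk; rewrite ltrNl lt_min => /andP[]; lra.
    have := dF _ _ y1; have := dF _ _ y2 => d1 d2.
    by apply: is_derive_eq; rewrite subrr.
  have const u v : - k < u -> u <= v ->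
      F (`|x| + 1) u - F m u = F (`|x| + 1) v - F m v.
    move=> ku uv.
    have [||z _] := @MVT_segment R (F (`|x| + 1) \- F m) (fun=> 0) u v uv.
    - move=> z; rewrite in_itv => /andP[uz _].
      by apply: dk; apply: lt_trans ku uz.
    - apply: derivable_within_continuous => z; rewrite in_itv => /andP[uz _].
      by have [] := dk z (lt_le_trans ku uz).
    by rewrite mul0r => /eqP; rewrite subr_eq0 => /eqP /esym.
  have [x0|x0] := leP 0 x.
    by have := const 0 x; rewrite /G; move: xk; rewrite ger0_norm //; lra.
  by have := const x 0; rewrite /G; move: xk; rewrite ltr0_norm //; lra.
exists G => x; pose m := `|x| + 1.
apply: (@near_eq_is_derive _ _ _ (fun y => F m y - F m 0)).
  have : \forall y \near x, `|y| < m.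
    have : `|x| < m by rewrite ltrDl.
    exact: (cvgr_lt _ (@norm_continuous _ _ x)).
  by apply: filterS => y ym; rewrite (GE m).
rewrite -[f x]subr0; apply: is_deriveB.
by apply: dF; have := ler_norm (- x); rewrite normrN /m; lra.
Qed.
End Antiderivative.

(** * Divided differences *)

Section DividedDifference.
Variable C : numFieldType.
Implicit Types (f : C -> C) (z a e : C) (E : seq C).

Lemma derivable_near f z : derivable f z 1 -> forall e, 0 < e ->
  \forall w \near z, `|f w - f z - 'D_1 f z * (w - z)| <= e * `|w - z|.
Proof.
move=> /derivable_nbhs /eqaddoP fz e e0.
have {}fz : \forall h \near (0 : C),
    `|f (h *: 1 + z) - (f z + h *: 'D_1 f z)| <= e * `|h| := fz e e0.
rewrite (near_shift z (0 : C)) in fz.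
apply: filterS fz => w /=.
rewrite /= /GRing.scale /= !mulr1 sub0r subrK opprD addrA.
by rewrite (mulrC ('D_1 f z)).
Qed.

(** The quotient extends continuously to a by the derivative there, but its
    differentiability at a is not claimed: this is why all statements allow a
    finite set of points where a function is only continuous. *)
Lemma divided_difference f E a : continuous f ->
    (forall z, z \notin E -> derivable f z 1) -> a \notin E ->
  exists h : C -> C, [/\ forall z, f z - f a = (z - a) * h z, continuous h &
    forall z, z \notin a :: E -> derivable h z 1].
Proof.
move=> cf df aE.
pose h z := if z == a then 'D_1 f a else (f z - f a) / (z - a).
pose q z := (f z - f a) * (z - a)^-1.
have hq z : z != a -> \forall w \near z, q w = h w.
  move=> za; have : \forall w \near z, w != a.
    exact: near_neq.
  by apply: filterS => w wa; rewrite /h (negPf wa).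
exists h; split=> [z|z|z].
- rewrite /h; case: eqVneq => [->|za]; first by rewrite !subrr mul0r.
  by rewrite mulrC divfK // subr_eq0.
- have [->|za] := eqVneq z a; last first.
    have cq : {for z, continuous q}.
      apply: continuousM.
        by apply: continuousB; [exact: cf | exact: cst_continuous].
      apply: continuousV; first by rewrite subr_eq0.
      by apply: continuousB; [exact: cvg_id | exact: cst_continuous].
    have hz : h z = q z by rewrite /h (negPf za).
    rewrite /continuous_at hz.
    exact: cvg_trans (near_eq_cvg (hq _ za)) cq.
  apply/(@cvgrPdist_le _ _ _ (nbhs a) _) => e e0.
  apply: filterS (derivable_near (df _ aE) e0) => w.
  rewrite /h eqxx; case: eqVneq => [_|wa].
    by rewrite subrr normr0 (ltW e0).
  have wa0 : 0 < `|w - a| by rewrite normr_gt0 subr_eq0.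
  rewrite -(ler_pdivrMr _ _ wa0) -normfV -normrM mulrBl mulfK ?subr_eq0 //.
  by rewrite distrC.
rewrite inE negb_or => /andP[za zE].
apply: near_eq_derivable (hq _ za) _.
apply: derivableM.
  by apply: derivableB; [exact: df | exact: derivable_cst].
apply: derivableV; first by rewrite subr_eq0.
by apply: derivableB; [exact: derivable_id | exact: derivable_cst].
Qed.
End DividedDifference.

(** * A Liouville theorem *)

Section ComplexPlane.
Variable R : realType.
Local Notation C := (Num.NumField.sort R[i]).
Local Notation Re := (@complex.Re R).
Local Notation Im := (@complex.Im R).
Implicit Types (f g : C -> C) (z w a : C) (E : seq C) (x y e : R).
Local Open Scope complex_scope.

Lemma Re_le_norm z e : `|z| <= e%:C -> `|Re z| <= e.
Proof. by move=> ze; rewrite -lecR (le_trans (normc_ge_Re z)). Qed.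

Lemma Im_le_norm z e : `|z| <= e%:C -> `|Im z| <= e.
Proof.
move=> ze; rewrite -normrN -ReiNIm; apply: Re_le_norm.
by rewrite normrM [X in _ * X]normc_def /= expr0n expr1n add0r sqrtr1 mulr1.
Qed.

Lemma norm_le_box x y : `|x +i* y| <= (`|x| + `|y|)%:C.
Proof.
rewrite normc_def lecR /= -[leRHS]ger0_norm ?addr_ge0 // -sqrtr_sqr.
rewrite ler_sqrt ?sqr_ge0 // sqrrD !real_normK ?num_real //.
by rewrite addrAC lerDl mulrn_wge0 // mulr_ge0.
Qed.

(** Neighborhoods in the complex plane, for which the radius is a complex
    number, contain squares with a real side. *)
Lemma near_box (P : C -> Prop) z : (\forall w \near z, P w) ->
  exists2 d : R, 0 < d & forall x y, `|x - Re z| < d -> `|y - Im z| < d ->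
    P (x +i* y).
Proof.
move=> /nbhs_ballP[e /= e0 zP]; have eE : e = (Re e)%:C.
  by rewrite RRe_real // gtr0_real.
have Re0 : 0 < Re e by rewrite -ltcR -eE.
exists (Re e / 2); first by rewrite divr_gt0.
move=> x y xz yz; apply: zP; rewrite -ball_normE /= eE distrC.
have -> : x +i* y - z = (x - Re z) +i* (y - Im z) by case: z xz yz.
by apply: le_lt_trans (norm_le_box _ _) _; rewrite ltcR; lra.
Qed.

Lemma continuous_box f z e : {for z, continuous f} -> 0 < e ->
  exists2 d : R, 0 < d & forall x y, `|x - Re z| < d -> `|y - Im z| < d ->
    `|Re (f (x +i* y)) - Re (f z)| <= e /\ `|Im (f (x +i* y)) - Im (f z)| <= e.
Proof.
move=> cf e0; have e0' : 0 < e%:C by rewrite ltcR.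
move/(@cvgrPdist_le _ _ _ (nbhs z) _) : cf => /(_ _ e0') /near_box[d d0 dP].
exists d => // x y xz yz; have := dP x y xz yz.
rewrite distrC => ze; rewrite -!raddfB.
by split; [exact: Re_le_norm | exact: Im_le_norm].
Qed.

Lemma Im_continuous_line f y :
  continuous f -> continuous (fun x => Im (f (x +i* y))).
Proof.
move=> cf x; apply/(@cvgrPdist_le _ _ _ (nbhs x) _) => e e0.
have [d d0 dP] := continuous_box (cf (x +i* y)) e0.
apply: filterS (nbhsx_ballx x _ d0) => t xt.
rewrite distrC; have [] // := dP t y; last by rewrite subrr normr0.
by rewrite distrC.
Qed.

Lemma Re_continuous_line f x :
  continuous f -> continuous (fun y => Re (f (x +i* y))).
Proof.
move=> cf y; apply/(@cvgrPdist_le _ _ _ (nbhs y) _) => e e0.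
have [d d0 dP] := continuous_box (cf (x +i* y)) e0.
apply: filterS (nbhsx_ballx y _ d0) => t yt.
rewrite distrC; have [] // := dP x t; first by rewrite subrr normr0.
by rewrite distrC.
Qed.

(** The Cauchy-Riemann equations: with g = u + i v the imaginary part of g dz
    is v dx + u dy, and v_y = u_x. *)
Lemma closed_at_derivable g z : derivable g z 1 ->
  closed_at (fun x y => Im (g (x +i* y))) (fun x y => Re (g (x +i* y)))
    (Re z) (Im z).
Proof.
move=> dg; case Ez: z (derivable_near dg) => [x0 y0] /= dgz.
case El: ('D_1 g _) dgz => [p q] dgz.
exists q, p, (- q) => e e0; have e0' : 0 < e%:C by rewrite ltcR.
have [d d0 dP] := near_box (dgz _ e0').
exists d => // x y xz yz; have := dP x y xz yz.
have -> : x +i* y - (x0 +i* y0) = (x - x0) +i* (y - y0) by [].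
move/le_trans/(_ (ler_wpM2l (ltW e0') (norm_le_box _ _))).
rewrite -rmorphM => le_e.
have := Im_le_norm le_e; have := Re_le_norm le_e.
case: (g _) => u v; case: (g _) => u0 v0 /=.
move=> le1 le2; split.
  by congr (`|_| <= _): le2; ring.
by congr (`|_| <= _): le1; ring.
Qed.

Lemma bounded_at_continuous g x0 y0 : {for x0 +i* y0, continuous g} ->
  bounded_at (fun x y => Im (g (x +i* y))) (fun x y => Re (g (x +i* y))) x0 y0.
Proof.
move=> cg; have [d d0 dP] := continuous_box cg ltr01.
exists (1 + `|Re (g (x0 +i* y0))| + `|Im (g (x0 +i* y0))|); exists d => //.
move=> x y xz yz; have [] := dP x y xz yz.
case: (g _) => u v; case: (g _) => u0 v0 /= /[!ler_distl].
have := ler_norm u0; have := ler_norm (- u0).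
have := ler_norm v0; have := ler_norm (- v0).
rewrite !normrN => *; split; rewrite ler_norml; lra.
Qed.
End ComplexPlane.

Lemma continuous_scale (K : numFieldType) (k : K) (h : K -> K) :
  continuous h -> continuous (fun z => k * h z).
Proof.
by move=> ch z; apply: continuousM; [exact: cst_continuous | exact: ch].
Qed.

Lemma derivable_scale (K : numFieldType) (k : K) (h : K -> K) z :
  derivable h z 1 -> derivable (fun z => k * h z) z 1.
Proof. by move=> dh; apply: derivableM; [exact: derivable_cst | exact: dh]. Qed.

Section Liouville.
Variable R : realType.
Local Notation C := (Num.NumField.sort R[i]).
Local Notation Re := (@complex.Re R).
Local Notation Im := (@complex.Im R).
Implicit Types (f g : C -> C) (z w a : C) (E : seq C) (x y e p q : R).
Local Open Scope complex_scope.

Lemma Re_div p q x y :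
  Re ((p +i* q) / (x +i* y)) = (p * x + q * y) / (x ^+ 2 + y ^+ 2).
Proof. by rewrite /=; ring. Qed.

Lemma Im_div p q x y :
  Im ((p +i* q) / (x +i* y)) = (q * x - p * y) / (x ^+ 2 + y ^+ 2).
Proof. by rewrite /=; ring. Qed.

Lemma norm_ge_Im z : `|Im z|%:C <= `|z|.
Proof.
have zE : `|z| = (Re `|z|)%:C by rewrite RRe_real // normr_real.
by rewrite zE lecR Im_le_norm // -zE.
Qed.

Lemma far_from_origin z w x : (`|x| + Re `|w|)%:C <= `|z - w| -> x%:C <= `|z|.
Proof.
move=> xzw; apply: (@le_trans _ _ `|x|%:C); first by rewrite lecR ler_norm.
have wE : `|w| = (Re `|w|)%:C by rewrite RRe_real // normr_real.
have := le_trans xzw (ler_normB z w).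
by rewrite [in X in _ <= X]wE rmorphD lerD2r.
Qed.

(** Liouville's theorem. If f(a) were nonzero, the imaginary part of g dz for
    g(z) = (1 - f(z) / f(a)) / (z - a) would be positive along every side of a
    large square around a, traversed counterclockwise. *)
Lemma vanishing_at_infinity f E a : continuous f ->
    (forall z, z \notin E -> derivable f z 1) -> a \notin E ->
    (forall e : C, 0 < e -> exists2 x : C, 0 < x &
       forall z, x <= `|z| -> `|f z| <= e) ->
  f a = 0.
Proof.
move=> cf df aE f_oo; apply/eqP; apply: contrapT => /negP fa0.
have [h [hE ch dh]] := divided_difference cf df aE.
pose g z := - (f a)^-1 * h z.
have cg : continuous g := continuous_scale (k := - (f a)^-1) ch.
have dg z : z \notin a :: E -> derivable g z 1.
  by move=> zE; apply: derivable_scale; exact: dh.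
have [x fx] : exists x : R, forall z, x%:C <= `|z| -> `|f z / f a| <= (1/4)%:C.
  have [|x x0 xP] := f_oo (`|f a| * (1/4)%:C).
    by rewrite mulr_gt0 ?normr_gt0 // ltcR; lra.
  exists (Re x) => z; rewrite RRe_real ?gtr0_real // => /xP.
  rewrite normrM normfV ler_pdivrMr ?normr_gt0 //.
  by rewrite mulrC.
have Rea0 : 0 <= Re `|a| by rewrite -ler0c RRe_real // normr_real.
(* A point at distance r from a is at distance at least |x| from 0. *)
pose r := `|x| + Re `|a| + 1.
have r0 : 0 < r by rewrite /r; have := normr_ge0 x; lra.
have far x1 y1 : r <= `|x1| \/ r <= `|y1| -> exists p q, [/\ 3/4 <= p,
    - (1/4) <= q <= 1/4 & g (a + (x1 +i* y1)) = (p +i* q) / (x1 +i* y1)].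
  move=> xy; set z := a + _.
  set d := x1 +i* y1.
  have rd : r%:C <= `|d|.
    by case: xy => xy; [apply: le_trans (normc_ge_Re d) |
      apply: le_trans (norm_ge_Im d)]; rewrite lecR.
  have zd : z - a = d by rewrite /z addrC addKr.
  have d0 : d != 0.
    by rewrite -normr_gt0; apply: lt_le_trans rd; rewrite ltcR.
  have k4 : `|f z / f a| <= (1/4)%:C.
    apply/fx/(far_from_origin (w := a)); rewrite zd; apply: le_trans rd.
    by rewrite lecR /r; lra.
  have gz : g z = (1 - f z / f a) / d.
    rewrite /g -zd -(divff fa0) -mulrBl -opprB hE zd; field.
    by rewrite fa0 d0.
  move: gz k4; case: (f z / f a) => u v -> k4.
  exists (1 - u), (- v).
  split; last by congr (_ / _); congr (_ +i* _); rewrite sub0r.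
    by have := Re_le_norm k4; rewrite ler_norml /=; lra.
  by have := Im_le_norm k4; rewrite ler_norml /=; lra.
pose P x1 y1 := Im (g (x1 +i* y1)).
pose Q x1 y1 := Re (g (x1 +i* y1)).
have /choice[H dH] y1 :=
  continuous_antiderivative (Im_continuous_line (y := y1) cg).
have /choice[V dV] x1 :=
  continuous_antiderivative (Re_continuous_line (x := x1) cg).
have dHP y1 x1 : is_derive x1 1 (H y1) (P x1 y1) := dH y1 x1.
have dVQ x1 y1 : is_derive y1 1 (V x1) (Q x1 y1) := dV x1 y1.
pose E' := [seq (Re z, Im z) | z <- a :: E].
pose x0 := Re a - r; pose y0 := Im a - r.
have := @goursat R P Q (fun x y => H y x) V E' x0 y0 (2 * r)
  (fun x y => dHP y x) dVQ.
have -> : x0 + 2 * r = Re a + r by rewrite /x0; ring.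
have -> : y0 + 2 * r = Im a + r by rewrite /y0; ring.
move=> circ0.
(* The numerators met on the four sides: p r >= 3 r / 4 outweighs q X,
   which is at most r / 4 in absolute value. *)
have num p q X : 3/4 <= p -> - (1/4) <= q <= 1/4 -> - r <= X <= r ->
    0 < p * r + q * X.
  move=> p3 q1 X1.
  have : 0 <= (1/4 + q) * (r + X) by apply: mulr_ge0; lra.
  have : 0 <= (1/4 - q) * (r - X) by apply: mulr_ge0; lra.
  have : 0 <= (p - 3/4) * r by apply: mulr_ge0; lra.
  by lra.
have onE X Y : (Re a + X) +i* (Im a + Y) = a + (X +i* Y) by case: (a).
have den X Y : r <= `|X| \/ r <= `|Y| -> 0 < X ^+ 2 + Y ^+ 2.
  have sqr_pos t : r <= `|t| -> 0 < t ^+ 2.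
    by move=> rt; rewrite exprn_even_gt0 //= -normr_gt0 (lt_le_trans r0).
  case=> /sqr_pos t0; first by rewrite ltr_pwDl ?sqr_ge0.
  by rewrite ltr_pwDr ?sqr_ge0.
have Pside X Y : r <= `|X| \/ r <= `|Y| -> exists p q,
  [/\ 3/4 <= p, - (1/4) <= q <= 1/4 &
      P (Re a + X) (Im a + Y) = (q * X - p * Y) / (X ^+ 2 + Y ^+ 2)].
  move=> XY; have [p [q [p3 q1 gE]]] := far X Y XY.
  by exists p, q; split=> //; rewrite /P onE gE Im_div.
have Qside X Y : r <= `|X| \/ r <= `|Y| -> exists p q,
  [/\ 3/4 <= p, - (1/4) <= q <= 1/4 &
      Q (Re a + X) (Im a + Y) = (p * X + q * Y) / (X ^+ 2 + Y ^+ 2)].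
  move=> XY; have [p [q [p3 q1 gE]]] := far X Y XY.
  by exists p, q; split=> //; rewrite /Q onE gE Re_div.
have rr : r <= `|r| by rewrite gtr0_norm.
have rNr : r <= `|- r| by rewrite normrN.
have xle : x0 <= Re a + r by rewrite /x0; lra.
have yle : y0 <= Im a + r by rewrite /y0; lra.
have bottom : 0 < H y0 (Re a + r) - H y0 x0.
  have [X X1 ->] := MVT_everywhere xle (dHP y0).
  rewrite (_ : X = Re a + (X - Re a)); last by ring.
  have [|p [q [p3 q1 sE]]] := Pside (X - Re a) (- r); first by right.
  rewrite sE.
  apply: mulr_gt0; last by rewrite /x0; lra.
  apply: divr_gt0; last by apply: den; right.
  by rewrite mulrN opprK addrC num // ; rewrite /x0 in X1; lra.
have top : H (Im a + r) (Re a + r) - H (Im a + r) x0 < 0.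
  have [X X1 ->] := MVT_everywhere xle (dHP (Im a + r)).
  rewrite (_ : X = Re a + (X - Re a)); last by ring.
  have [|p [q [p3 q1 sE]]] := Pside (X - Re a) r; first by right.
  rewrite sE.
  rewrite -oppr_gt0 -mulNr -mulNr; apply: mulr_gt0; last by rewrite /x0; lra.
  apply: divr_gt0; last by apply: den; right.
  by rewrite opprB -mulrN num // ; rewrite /x0 in X1; lra.
have right_side : 0 < V (Re a + r) (Im a + r) - V (Re a + r) y0.
  have [Y Y1 ->] := MVT_everywhere yle (dVQ (Re a + r)).
  rewrite (_ : Y = Im a + (Y - Im a)); last by ring.
  have [|p [q [p3 q1 sE]]] := Qside r (Y - Im a); first by left.
  rewrite sE.
  apply: mulr_gt0; last by rewrite /y0; lra.
  apply: divr_gt0; last by apply: den; left.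
  by rewrite num // ; rewrite /y0 in Y1; lra.
have left_side : V x0 (Im a + r) - V x0 y0 < 0.
  have [Y Y1 ->] := MVT_everywhere yle (dVQ x0).
  rewrite (_ : Y = Im a + (Y - Im a)); last by ring.
  have [|p [q [p3 q1 sE]]] := Qside (- r) (Y - Im a); first by left.
  rewrite sE.
  rewrite -oppr_gt0 -mulNr -mulNr; apply: mulr_gt0; last by rewrite /y0; lra.
  apply: divr_gt0; last by apply: den; left.
  by rewrite mulrN opprD opprK -mulrN num // ; rewrite /y0 in Y1; lra.
suff : circulation (fun x y => H y x) V x0 (Re a + r) y0 (Im a + r) = 0.
  by rewrite /circulation; lra.
apply: circ0; last by rewrite mulr_gt0.
  move=> x1 y1 xyE; apply: (@closed_at_derivable R g (x1 +i* y1)); apply: dg.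
  by apply: contra xyE => /(map_f (fun z => (Re z, Im z))).
by move=> x1 y1 _; apply: bounded_at_continuous; exact: cg.
Qed.
End Liouville.

(** * Polynomial growth and meromorphic functions *)

Section Growth.
Variable C : numFieldType.
Implicit Types (f h : C -> C) (z w a e : C) (E : seq C) (p q : {poly C}).

Lemma derivable_poly p z : derivable (horner p) z 1.
Proof.
elim/poly_ind: p => [|p c ih].
  rewrite (_ : horner 0 = cst 0); first exact: derivable_cst.
  by apply/funext => w; rewrite horner0.
rewrite (_ : horner _ = horner p * id + cst c); last first.
  by apply/funext => w; rewrite hornerMXaddC.
apply: derivableD; last exact: derivable_cst.
by apply: derivableM; [exact: ih | exact: derivable_id].
Qed.

Lemma norm_horner_le p : exists2 k : C, 0 < k &
  forall z, 1 <= `|z| -> `|p.[z]| <= k * `|z| ^+ size p.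
Proof.
exists (1 + \sum_(i < size p) `|p`_i|).
  by rewrite ltr_pwDl // sumr_ge0.
move=> z z1; rewrite mulrDl mul1r -[leLHS]add0r lerD ?exprn_ge0 //.
rewrite horner_coef mulr_suml; apply: le_trans (ler_norm_sum _ _ _) _.
apply: ler_sum => i _; rewrite normrM normrX ler_wpM2l //.
by rewrite ler_weXn2l // ltnW.
Qed.

Lemma derivable_continuous f z : derivable f z 1 -> {for z, continuous f}.
Proof. by move=> /derivable1_diffP; exact: differentiable_continuous. Qed.

Lemma exists_notin E : exists a, a \notin E.
Proof.
have [[z|] //] := @punctured_inhabited C (None :: map Some E).
by rewrite inE /= mem_map => [zE|x y []//]; exists z.
Qed.

(** For |z| large, |z - a| is at least |z| / 2 and f(a) is negligible. *)
Lemma growth_divided_difference f h a n :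
    (forall z, f z - f a = (z - a) * h z) ->
    (forall e, 0 < e -> exists2 x, 0 < x &
       forall z, x <= `|z| -> `|f z| <= e * `|z| ^+ n.+1) ->
  forall e, 0 < e -> exists2 x, 0 < x &
       forall z, x <= `|z| -> `|h z| <= e * `|z| ^+ n.
Proof.
move=> hE f_oo e e0; have e4 : 0 < e / 4 by rewrite divr_gt0.
have [x x0 xP] := f_oo _ e4.
pose x' := x + 1 + 2 * `|a| + `|f a| / (e / 4).
have fa0 : 0 <= `|f a| / (e / 4) by rewrite divr_ge0 // ltW.
have a0 : 0 <= 2 * `|a| by rewrite mulr_ge0.
have x'0 : 0 < x' by rewrite /x' ltr_wpDr // ltr_wpDr // addr_gt0.
exists x' => // z zx.
have z1 : 1 <= `|z|.
  apply: le_trans zx; rewrite /x' -!addrA addrCA lerDl !addr_ge0 //.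
  by rewrite ltW.
have zx0 : x <= `|z|.
  by apply: le_trans zx; rewrite /x' -!addrA lerDl !addr_ge0.
have za : 2 * `|a| <= `|z|.
  by apply: le_trans zx; rewrite /x' addrAC lerDr !addr_ge0 // ltW.
have zfa : `|f a| <= e / 4 * `|z|.
  rewrite mulrC -ler_pdivrMr //; apply: le_trans zx.
  by rewrite /x' lerDr !addr_ge0 // ltW.
have za2 : `|z| / 2 <= `|z - a|.
  apply: le_trans (lerB_dist z a); rewrite lerBrDr.
  by rewrite [leRHS](splitr `|z|) lerD2l ler_pdivlMr // mulrC.
have z0 : 0 < `|z| by apply: lt_le_trans z1.
have za0 : 0 < `|z - a| by apply: lt_le_trans za2; rewrite divr_gt0.
rewrite -(ler_pM2l za0) -normrM -hE.
apply: le_trans (ler_normB _ _) _.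
apply: le_trans (_ : e / 4 * `|z| ^+ n.+1 + e / 4 * `|z| ^+ n.+1 <= _).
  apply: lerD; first exact: xP.
  apply: le_trans zfa _; rewrite ler_wpM2l ?(ltW e4) //.
  by rewrite exprS ler_peMr ?exprn_ege1 // ltW.
apply: le_trans (ler_wpM2r _ za2); last by rewrite mulr_ge0 ?exprn_ge0 // ltW.
by rewrite exprS le_eqVlt; apply/orP; left; apply/eqP; field.
Qed.
End Growth.

Section Polynomial.
Variable R : realType.
Local Notation C := (Num.NumField.sort R[i]).
Implicit Types (f g : C -> C) (z w a : C) (E : seq C).

(** Induction on n: the divided difference of f at a point a outside E grows
    more slowly and is differentiable outside a :: E. *)
Lemma polynomial_growth n f E : continuous f ->
    (forall z, z \notin E -> derivable f z 1) ->
    (forall e : C, 0 < e -> exists2 x : C, 0 < x &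
       forall z, x <= `|z| -> `|f z| <= e * `|z| ^+ n) ->
  exists p : {poly C}, forall z, z \notin E -> f z = p.[z].
Proof.
elim: n f E => [|n ih] f E cf df f_oo.
  exists 0 => z zE; rewrite horner0; apply: vanishing_at_infinity cf df zE _.
  move=> e e0; have [x x0 xP] := f_oo e e0; exists x => // w /xP.
  by rewrite expr0 mulr1.
have [a aE] := exists_notin E.
have [h [hE ch dh]] := divided_difference cf df aE.
have [q qP] := ih h (a :: E) ch dh (growth_divided_difference hE f_oo).
exists ((f a)%:P + ('X - a%:P) * q) => z zE; rewrite !hornerE.
have [->|za] := eqVneq z a; first by rewrite subrr mul0r addr0.
by rewrite -qP ?inE ?negb_or ?za // -hE addrC subrK.
Qed.
End Polynomial.

Section Meromorphic.
Variable C : numFieldType.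
Implicit Types (f h : C -> C) (z w a e k : C) (E : seq C) (p q : {poly C}).

Lemma holomorphic_derivable f z : holomorphic_at f z -> derivable f z 1.
Proof. exact: nbhs_singleton. Qed.

(** The function f has at a at most a pole of order n. *)
Definition pole_le (n : nat) f a := exists k,
  \forall w \near a^'%classic, `|(w - a) ^+ n * f w| <= k.

Lemma meromorphic_pole f a : meromorphic_at f a -> exists n, pole_le n f a.
Proof.
move=> [n [h hh fh]]; exists n, (`|h a| + 1).
have ch : {for a, continuous h}.
  exact/derivable_continuous/holomorphic_derivable.
have hk : \forall w \near a, `|h w| <= `|h a| + 1.
  move/(@cvgrPdist_le _ _ _ (nbhs a) _) : ch => /(_ 1 ltr01).
  apply: filterS => w hw.
  rewrite -[h w](subKr (h a)) (le_trans (ler_normB _ _)) //.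
  by rewrite lerD2l.
apply: filterS2 fh (nbhs_dnbhs hk) => w -> //.
Qed.

Lemma poles_bounded f E : (forall a, a \in E -> exists n, pole_le n f a) ->
  exists N, forall a, a \in E -> exists2 n, (n < N)%N & pole_le n f a.
Proof.
elim: E => [|b E ih] fE; first by exists 0%N.
have [a aE|N NP] := ih; first by apply: fE; rewrite inE aE orbT.
have [|n nP] := fE b; first by rewrite mem_head.
exists (maxn N n.+1) => a; rewrite inE => /predU1P[->|/NP[m mN mP]].
  by exists n => //; rewrite leq_max leqnn orbT.
by exists m => //; rewrite leq_max mN.
Qed.

(** The exponent is one more than the order of the pole: the product vanishes
    at a, so that it is continuous there whatever the value of f at a. *)
Lemma pole_cancel f a n p : pole_le n f a ->
  {for a, continuous (fun w => (('X - a%:P) ^+ n.+1 * p).[w] * f w)}.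
Proof.
move=> [k fk].
apply/(@cvgrPdist_le _ _ _ (nbhs a) _) => e e0.
have k1 : 0 < `|k| + 1 by rewrite ltr_wpDl.
have c0 : {for a, continuous (horner (('X - a%:P) * p))}.
  exact/derivable_continuous/derivable_poly.
have pk : \forall w \near a, `|(w - a) * p.[w]| <= e / (`|k| + 1).
  move/(@cvgrPdist_le _ _ _ (nbhs a) _) : c0 => /(_ _ (divr_gt0 e0 k1)).
  by apply: filterS => w; rewrite !hornerE subrr mul0r sub0r normrN.
have {}fk : \forall w \near a, w != a -> `|(w - a) ^+ n * f w| <= k := fk.
apply: filterS2 fk pk => w fk pe.
rewrite [X in X - _](_ : _ = 0); last by rewrite !hornerE subrr expr0n !mul0r.
rewrite sub0r normrN.
have [->|wa] := eqVneq w a.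
  by rewrite !hornerE subrr expr0n !mul0r normr0 ltW.
rewrite !hornerE exprS.
rewrite (_ : _ * _ = ((w - a) ^+ n * f w) * ((w - a) * p.[w])); last by ring.
rewrite normrM -[e](@divfK _ (`|k| + 1)) ?lt0r_neq0 // mulrC.
apply: ler_pM => //; apply: le_trans (fk wa) _.
have k0 : 0 <= k := le_trans (normr_ge0 _) (fk wa).
by rewrite ger0_norm // lerDl.
Qed.

End Meromorphic.

Section Rational.
Variable R : realType.
Local Notation C := (Num.NumField.sort R[i]).
Implicit Types (f g : C -> C) (z w a : C) (E : seq C).

(** Multiplied by a large power of the product of the z - a, the function f is
    continuous on the whole plane and grows like a polynomial. *)
Lemma meromorphic_rational f E :
    (forall z, z \notin E -> derivable f z 1) ->
    (forall a, a \in E -> exists n, pole_le n f a) ->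
    (exists n : nat, exists k x : C, [/\ 0 < k, 0 < x &
       forall z, x <= `|z| -> `|f z| <= k * `|z| ^+ n]) ->
  exists N (p : {poly C}), forall z, z \notin E ->
    (\prod_(a <- E) ('X - a%:P)).[z] ^+ N * f z = p.[z].
Proof.
move=> df fE [n [k [x [k0 x0 f_oo]]]]; have [N NP] := poles_bounded fE.
set q := \prod_(a <- E) _; pose g z := (q ^+ N).[z] * f z.
have dg z : z \notin E -> derivable g z 1.
  by move=> zE; apply: derivableM; [exact: derivable_poly | exact: df].
have cg : continuous g.
  move=> z; have [zE|zE] := boolP (z \in E); last first.
    exact/derivable_continuous/dg.
  have [m mN fz] := NP z zE.
  have qE : q ^+ N = ('X - z%:P) ^+ m.+1 *
      (('X - z%:P) ^+ (N - m.+1) * (\prod_(a <- rem z E) ('X - a%:P)) ^+ N).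
    by rewrite mulrA -exprD subnKC // -exprMn /q (big_rem _ zE).
  by rewrite /g qE; exact: pole_cancel.
have [c c0 qc] := norm_horner_le (q ^+ N).
have g_oo (e : C) : 0 < e -> exists2 y : C, 0 < y & forall z, y <= `|z| ->
    `|g z| <= e * `|z| ^+ (size (q ^+ N) + n).+1.
  move=> e0; pose y := 1 + x + c * k / e.
  have cke : 0 < c * k / e by rewrite divr_gt0 ?mulr_gt0.
  exists y; first by rewrite /y !addr_gt0.
  move=> z yz.
  have z1 : 1 <= `|z|.
    by apply: le_trans yz; rewrite /y -addrA lerDl addr_ge0 // ltW.
  have zx : x <= `|z|.
    by apply: le_trans yz; rewrite /y addrAC lerDr addr_ge0 // ltW.
  have zc : c * k <= e * `|z|.
    rewrite -ler_pdivrMl // mulrC; apply: le_trans yz.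
    by rewrite /y lerDr addr_ge0 // ltW.
  rewrite normrM; apply: le_trans (ler_pM _ _ (qc _ z1) (f_oo _ zx)) _ => //.
  by rewrite exprS exprD mulrACA [leRHS]mulrA ler_wpM2r ?mulr_ge0 ?exprn_ge0.
have [p pP] := polynomial_growth cg dg g_oo.
exists N, p => z zE; rewrite -pP // /g.
by rewrite horner_exp.
Qed.
End Rational.

(** * Regular functions on the punctured sphere *)

Section RegularFunctions.
Variable C : numFieldType.
Implicit Types (f g h : C -> C) (z w a e k : C).

Lemma derivable_shift f a w :
  derivable (fun t => f (a + t)) w 1 <-> derivable f (a + w) 1.
Proof.
rewrite /derivable (_ : (fun t => _) = (fun t : C =>
  t^-1 *: ((f \o shift (a + w)) (t *: 1) - f (a + w)))) //.
by apply/funext => t /=; rewrite addrCA.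
Qed.

Lemma holomorphic_at_shift f a :
  holomorphic_at f a -> holomorphic_at (fun t => f (a + t)) 0.
Proof.
move=> hf; rewrite /holomorphic_at.
have : \forall t \near (0 : C), derivable f (t + (a - 0)) 1.
  by rewrite -(near_shift 0 a (fun w => derivable f w 1)).
by apply: filterS => t; rewrite subr0 addrC => dfat; apply/derivable_shift.
Qed.

Lemma holomorphic_atV f z : holomorphic_at f z -> f z != 0 ->
  holomorphic_at (fun w => (f w)^-1) z.
Proof.
move=> hf fz0; have cf : {for z, continuous f}.
  exact/derivable_continuous/holomorphic_derivable.
have fz : \forall w \near z, f w != 0.
  move: (near_neq fz0) => /cf; exact.
by apply: filterS2 hf fz => w df fw; exact: derivableV.
Qed.

Lemma holomorphic_at_id z : holomorphic_at id z.
Proof. by apply: filterE => w; exact: derivable_id. Qed.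

Lemma holomorphic_meromorphic f z : holomorphic_at f z -> meromorphic_at f z.
Proof. by exists 0%N, f => //; apply: filterE => w; rewrite expr0 mul1r. Qed.

Lemma near_meromorphic f g z : (\forall w \near z^'%classic, f w = g w) ->
  meromorphic_at f z -> meromorphic_at g z.
Proof.
move=> fg [n [h hh fh]]; exists n, h => //.
by apply: filterS2 fg fh => w ->.
Qed.

Variable S : seq (P1 C).
Hypothesis S_oo : None \in S.

(** The affine coordinate, which is defined on the whole punctured sphere when
    the point at infinity is removed. *)
Definition pcoord (p : punctured S) : C := odflt 0 (val p).

Lemma pcoordE (p : punctured S) : Some (pcoord p) = val p.
Proof.
case: p => [[z|] pS] /=; rewrite /pcoord //=.
by move: (pS); rewrite S_oo.
Qed.

Lemma extend_pcoord f z : Some z \notin S ->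
  extend (f \o pcoord) (Some z) = f z.
Proof.
by move=> zS; rewrite /extend insubT /= /pcoord SubK.
Qed.

Lemma regular_pcoord f :
    (forall z, Some z \notin S -> holomorphic_at f z) ->
    (forall z, Some z \in S -> meromorphic_at f z) ->
    meromorphic_at (fun t => f t^-1) 0 ->
  regular_outside (f \o pcoord).
Proof.
move=> hf mf foo; split=> [[a|]|[a|]] aS; last 1 first.
- apply: near_meromorphic foo.
  apply: filterS2 (dnear_chart_notin S None) (nbhs_dnbhs_neq (0 : C)) => t /=.
  by move=> + t0; rewrite (negPf t0) => tS; rewrite extend_pcoord.
- apply: near_holomorphic (holomorphic_at_shift (hf _ aS)).
  by apply: filterS (near_chart_notin aS) => t tS; rewrite /= extend_pcoord.
- by rewrite S_oo in aS.
have [n [h hh fh]] := mf a aS; exists n, (fun t => h (a + t)).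
  exact: holomorphic_at_shift.
have {}fh : \forall w \near a, w != a -> (w - a) ^+ n * f w = h w := fh.
rewrite (near_shift 0 a) in fh.
have {}fh : \forall t \near 0^'%classic,
    (t + (a - 0) - a) ^+ n * f (t + (a - 0)) = h (t + (a - 0)).
  apply: filterS fh => t /= ft t0; apply: ft.
  by rewrite subr0 -subr_eq0 addrK.
apply: filterS2 fh (dnear_chart_notin S (Some a)) => t.
by rewrite !subr0 addrK addrC => ft tS; rewrite /= extend_pcoord.
Qed.

Lemma regular_coordinate : regular_outside pcoord.
Proof.
apply: (@regular_pcoord id) => [z _|z _|].
- exact: holomorphic_at_id.
- exact/holomorphic_meromorphic/holomorphic_at_id.
exists 1%N, (fun=> 1); first exact: holomorphic_at_cst.
by apply: filterS (nbhs_dnbhs_neq (0 : C)) => t t0; rewrite subr0 mulfV.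
Qed.

Lemma regular_inverse a : Some a \in S ->
  regular_outside (fun p => (pcoord p - a)^-1).
Proof.
move=> aS; pose f w := (w - a)^-1.
have h1 w : holomorphic_at (fun t => t - a) w.
  apply: holomorphic_atD; first exact: holomorphic_at_id.
  exact: holomorphic_at_cst.
have hf w : w != a -> holomorphic_at f w.
  by move=> wa; apply: holomorphic_atV; [exact: h1 | rewrite subr_eq0].
apply: (@regular_pcoord f) => [z zS|z zS|].
- by apply: hf; apply: contraNneq zS => ->.
- have [->|za] := eqVneq z a; last exact/holomorphic_meromorphic/hf.
  exists 1%N, (fun=> 1); first exact: holomorphic_at_cst.
  apply: filterS (nbhs_dnbhs_neq a) => t ta.
  by rewrite /f mulfV // subr_eq0.
(* At infinity, (t^-1 - a)^-1 = t / (1 - a t). *)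
exists 0%N, (fun t => t * (1 + - a * t)^-1).
  apply: holomorphic_atM; first exact: holomorphic_at_id.
  apply: holomorphic_atV; last by rewrite mulr0 addr0 oner_eq0.
  apply: holomorphic_atD; first exact: holomorphic_at_cst.
  apply: holomorphic_atM; first exact: holomorphic_at_cst.
  exact: holomorphic_at_id.
apply: filterS (nbhs_dnbhs_neq (0 : C)) => t t0.
rewrite expr0 mul1r /f.
have -> : t^-1 - a = (1 + - a * t) / t by rewrite mulrDl mul1r mulfK.
by rewrite invf_div.
Qed.
End RegularFunctions.

Section RegularAlgebraElements.
Variables (C : numFieldType) (S : seq (P1 C)) (glue : seq (P1 C * P1 C)).
Implicit Types (pt : punctured S) (z w a : C) (p : {poly C}).
Local Notation A := (regular_alg S glue).

Definition regular_elt (f : punctured S -> C) (rf : regular_outside f)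
    (gf : forall p q : punctured S, (val p, val q) \in glue -> f p = f q) : A :=
  exist _ f (asboolT (conj rf gf)).

Lemma regular_horner (x : A) p pt : val (horner_alg x p) pt = p.[val x pt].
Proof.
elim/poly_ind: p => [|p c ih]; first by rewrite rmorph0 horner0.
rewrite rmorphD rmorphM /= horner_algX horner_algC hornerMXaddC -ih.
by rewrite -[c in RHS]mulr1.
Qed.

Lemma regular_exp (x : A) n pt : val (x ^+ n) pt = val x pt ^+ n.
Proof. by elim: n => [//|n ih]; rewrite !exprS -ih. Qed.

(** A polynomial vanishing at x vanishes at all nonzero values of x. *)
Lemma regular_transcendental (x : A) :
    (forall w, w != 0 -> exists pt, val x pt = w) ->
  forall p, horner_alg x p = 0 -> p = 0.
Proof.
move=> xw p xp0; pose s : seq C := [seq n.+1%:R | n <- iota 0 (size p)].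
apply: (@roots_geq_poly_eq0 _ _ s).
- apply/allP => _ /mapP[n _ ->]; have [|pt <-] := xw n.+1%:R.
    by rewrite pnatr_eq0.
  by rewrite /root -regular_horner xp0.
- rewrite map_inj_uniq ?iota_uniq // => m n /eqP.
  by rewrite eqr_nat => /eqP[].
- by rewrite size_map size_iota.
Qed.

(** The hypotheses of [meromorphic_rational], read off in the charts of the
    sphere. At infinity the chart is z = 1/t, so a pole of order n in t means
    growth of order n in z. *)
Lemma regular_plane (E : seq C) (f : A) : S =i None :: map Some E ->
  let F z := extend (val f) (Some z) in
  [/\ forall z, z \notin E -> derivable F z 1,
      forall a, a \in E -> exists n, pole_le n F a &
      exists n : nat, exists k x : C, [/\ 0 < k, 0 < x &
        forall z, x <= `|z| -> `|F z| <= k * `|z| ^+ n]].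
Proof.
move=> SE F; have /asboolP[[hf mf] _] := valP f.
have S_oo : None \in S by rewrite SE mem_head.
have SomeE z : (Some z \in S) = (z \in E).
  by rewrite SE inE /= mem_map // => x y [].
have dF z : z \notin E -> derivable F z 1.
  move=> zE; have := hf (Some z); rewrite SomeE => /(_ zE).
  move=> /holomorphic_derivable.
  by move/(derivable_shift F z 0); rewrite addr0.
have pF a : a \in E -> exists n, pole_le n F a.
  move=> aE; have := mf (Some a); rewrite SomeE => /(_ aE).
  move=> /meromorphic_pole[n [k nk]]; exists n, k.
  have {}nk : \forall t \near (0 : C),
    t != 0 -> `|(t - 0) ^+ n * F (a + t)| <= k := nk.
  rewrite (near_shift a 0) in nk.
  apply: filterS nk => w /= nk wa; move: nk.
  rewrite sub0r subr0 subr_eq0 => /(_ wa).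
  by rewrite (addrC a) subrK.
have F_oo : exists n : nat, exists k x : C, [/\ 0 < k, 0 < x &
    forall z, x <= `|z| -> `|F z| <= k * `|z| ^+ n].
  have [n [k fk]] := meromorphic_pole (mf _ S_oo).
  have {}fk : \forall t \near (0 : C), t != 0 -> `|t ^+ n * F t^-1| <= k.
    have {}fk : \forall t \near (0 : C), t != 0 ->
      `|(t - 0) ^+ n * (extend (val f) \o chart None) t| <= k := fk.
    apply: filterS fk => t + t0 => /(_ t0).
    by rewrite subr0 /= (negPf t0).
  have [d /= d0 dP] := (nbhs_ballP _ _).1 fk.
  have dF' z : 2 / d <= `|z| -> 0 < `|z| /\ `|F z| <= k * `|z| ^+ n.
    move=> zd; have z0 : 0 < `|z| by apply: lt_le_trans zd; rewrite divr_gt0.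
    split=> //; have := dP z^-1.
    rewrite -ball_normE /= sub0r normrN normfV invr_eq0 -normr_gt0 invrK.
    move=> /(_ _ z0); rewrite normrM normrX normfV exprVn mulrC.
    rewrite ler_pdivrMr ?exprn_gt0 //; apply.
    rewrite -[d]invrK ltf_pV2 ?qualifE //= ?invr_gt0 //.
    by apply: lt_le_trans zd; rewrite ltr_pMl ?invr_gt0 // ltr1n.
  exists n, (`|k| + 1), (2 / d); split=> [||z zd].
  - by rewrite ltr_wpDl.
  - by rewrite divr_gt0.
  have [z0 zF] := dF' z zd.
  have k0 : 0 <= k.
    by have := le_trans (normr_ge0 _) zF; rewrite pmulr_lge0 ?exprn_gt0.
  apply: le_trans zF _; rewrite ler_pM2r ?exprn_gt0 //.
  by rewrite ger0_norm // lerDl.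
by [].
Qed.
End RegularAlgebraElements.

Section RegularRational.
Variables (R : realType) (S : seq (P1 R[i])) (glue : seq (P1 R[i] * P1 R[i])).
Local Notation C := (Num.NumField.sort R[i]).

Lemma regular_rational (E : seq C) (f : regular_alg S glue) :
  S =i None :: map Some E -> exists N (p : {poly C}), forall pt : punctured S,
    (\prod_(a <- E) ('X - a%:P)).[pcoord pt] ^+ N * val f pt = p.[pcoord pt].
Proof.
move=> SE; have [dF pF F_oo] := regular_plane f SE.
have [N [p pP]] := meromorphic_rational dF pF F_oo.
have S_oo : None \in S by rewrite SE mem_head.
exists N, p => pt; rewrite -pP; first by rewrite pcoordE // /extend valK.
have : Some (pcoord pt) \notin S by rewrite pcoordE // (valP pt).
by rewrite SE inE /= mem_map // => x y [].
Qed.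
End RegularRational.

(** * The three isomorphisms *)

Section Criterion.
Variables (K : fieldType) (e1 e2 : K) (g : finLieAlgType K) (B : comAlgType K).

Definition attained (A : comAlgType K) (phi : A -> B) b := exists a, phi a = b.

Section Attained.
Variables (A : comAlgType K) (phi : {lrmorphism A -> B}).

Lemma attainedD b b' :
  attained phi b -> attained phi b' -> attained phi (b + b').
Proof. by move=> [a <-] [a' <-]; exists (a + a'); rewrite rmorphD. Qed.

Lemma attainedM b b' :
  attained phi b -> attained phi b' -> attained phi (b * b').
Proof. by move=> [a <-] [a' <-]; exists (a * a'); rewrite rmorphM. Qed.

Lemma attainedZ c b : attained phi b -> attained phi (c *: b).
Proof. by move=> [a <-]; exists (c *: a); rewrite linearZ. Qed.

Lemma attainedX b n : attained phi b -> attained phi (b ^+ n).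
Proof. by move=> [a <-]; exists (a ^+ n); rewrite rmorphXn. Qed.

Lemma attained_horner b p : attained phi b -> attained phi (horner_alg b p).
Proof.
by move=> [a <-]; exists (horner_alg a p); rewrite lrmorph_horner_alg.
Qed.
End Attained.

(** The two halves of bijectivity: transcendence of the image of A_2 gives
    injectivity. *)
Lemma kn_current_isom (phi : {lrmorphism kn_comAlg e1 e2 -> B}) :
    (forall p, horner_alg (phi (knA e1 e2 2)) p = 0 -> p = 0) ->
    (forall b, attained phi b) ->
  lie_isom (kn_current e1 e2 g) (current g B).
Proof.
move=> phi_tr phi_surj; apply: (@current_isom K g (kn_comAlg e1 e2) B phi).
have /choice[psi psiK] := phi_surj.
by exists psi => // a; apply: (kn_injective phi_tr); rewrite psiK.
Qed.
End Criterion.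

Section Laurent.
Variable K : fieldType.

(** For e1 = e2 = 0 the two algebras have the same structure constants in
    their bases. *)
Lemma kn_laurent (g : finLieAlgType K) :
  lie_isom (kn_current (0 : K) 0 g) (current g (laurent K)).
Proof.
pose phi (f : kn_comAlg (0 : K) 0) : laurent K := f.
have phi_lin : linear phi by [].
have phi_mon : monoid_morphism phi.
  split=> // f h; apply: eq_bigr => n _; apply: eq_bigr => m _.
  congr (_ *: _); rewrite /kn_coef /laurent_coef.
  by case: ifP => // _; rewrite !(mulr0, add0r, subr0, mul0r, scale0r, addr0).
pose Phi : {lrmorphism kn_comAlg (0 : K) 0 -> laurent K} :=
  HB.pack phi
    (GRing.isLinear.Build K (kn_comAlg (0 : K) 0) (laurent K) *:%R phi phi_lin)
    (GRing.isMonoidMorphism.Build (kn_comAlg (0 : K) 0) (laurent K)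
       phi phi_mon).
by apply: (@current_isom K g (kn_comAlg 0 0) (laurent K) Phi); exists id.
Qed.
End Laurent.

Section NodalCurves.
Variable C : numFieldType.
(* The algebraic part is carried out over an abstract field, of which only these
   two properties of the complex numbers are used. *)
Hypothesis sqrt_exists : forall a : C, exists b : C, b ^+ 2 = a.
Hypothesis rational_regular : forall (S : seq (P1 C)) glue (E : seq C)
    (f : regular_alg S glue),
  S =i None :: map Some E -> exists N (p : {poly C}), forall pt : punctured S,
    (\prod_(a <- E) ('X - a%:P)).[pcoord pt] ^+ N * val f pt = p.[pcoord pt].

(** Here y = mu z and x = mu^2 (z^2 - alpha^2); the condition on e1 and e2
    removes the term in x', so that y^2 = x + 3 e1. *)
Lemma kn_Valg (e1 e2 alpha : C) (g : finLieAlgType C) :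
    (e1 - e2) * (2 * e1 + e2) = 0 -> e1 != 0 -> alpha != 0 ->
  lie_isom (kn_current e1 e2 g) (current g (Valg alpha)).
Proof.
move=> c0 e10 al0.
pose S : seq (P1 C) := [:: Some alpha; Some (- alpha); None].
have S_oo : None \in S by rewrite !inE orbT.
have noglue (f : punctured S -> C) (p q : punctured S) :
  (val p, val q) \in [::] -> f p = f q by [].
have aS : Some alpha \in S by rewrite !inE eqxx.
have NaS : Some (- alpha) \in S by rewrite !inE eqxx orbT.
pose Z : Valg alpha := regular_elt (regular_coordinate S_oo) (noglue _).
pose U : Valg alpha := regular_elt (regular_inverse S_oo aS) (noglue _).
pose W : Valg alpha := regular_elt (regular_inverse S_oo NaS) (noglue _).
have pt_al (pt : punctured S) :
    (pcoord pt - alpha != 0) && (pcoord pt + alpha != 0).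
  have := valP pt; rewrite /= -pcoordE // !inE !negb_or => /and3P[h1 h2 _].
  rewrite subr_eq0 -[alpha in X in _ && X]opprK subr_eq0.
  by apply/andP; split; [apply: contraNneq h1 | apply: contraNneq h2] => ->.
have [s sE] := sqrt_exists (3 * e1).
have s0 : s != 0 by rewrite -sqrf_eq0 sE mulf_neq0 // pnatr_eq0.
(* This normalization makes y^2 - x = mu^2 alpha^2 the constant 3 e1. *)
pose mu := s / alpha; have mu0 : mu != 0 by rewrite mulf_neq0 ?invr_eq0.
have muE : mu ^+ 2 * alpha ^+ 2 = 3 * e1 by rewrite -exprMn divfK.
pose x : Valg alpha := mu ^+ 2 *: (Z * Z - (alpha ^+ 2)%:A).
pose x' : Valg alpha := mu ^- 2 *: (U * W).
pose y : Valg alpha := mu *: Z.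
have xE pt : val x pt = mu ^+ 2 * (pcoord pt ^+ 2 - alpha ^+ 2).
  by rewrite /x /= -[alpha ^+ 2 in RHS]mulr1.
have x'E pt : val x' pt =
    mu ^- 2 * ((pcoord pt - alpha)^-1 * (pcoord pt + alpha)^-1).
  by have -> : pcoord pt + alpha = pcoord pt - - alpha by rewrite opprK.
have yE pt : val y pt = mu * pcoord pt by [].
clearbody x x' y.
have xx' : x * x' = 1.
  apply/val_inj/funext => pt; have /andP[h1 h2] := pt_al pt.
  rewrite [LHS](_ : _ = val x pt * val x' pt) // [RHS](_ : _ = 1 :> C) //.
  by rewrite xE x'E; field; rewrite mu0 h1 h2.
have yy : y * y = x + (3 * e1) *: 1 + ((e1 - e2) * (2 * e1 + e2)) *: x'.
  rewrite c0 scale0r addr0; apply/val_inj/funext => pt.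
  rewrite [RHS](_ : _ = val x pt + 3 * e1 * 1) // xE -muE.
  by rewrite [LHS](_ : _ = val y pt * val y pt) // yE; ring.
have [phi [phi_x phi_x' phi_y]] := kn_mapP xx' yy.
apply: (@kn_current_isom _ _ _ g _ phi).
  rewrite phi_x; apply: regular_transcendental => w w0.
  have [z zE] := sqrt_exists (w / mu ^+ 2 + alpha ^+ 2).
  have zS : Some z \notin S.
    have nz : z ^+ 2 != alpha ^+ 2.
      by rewrite zE -subr_eq0 addrK mulf_neq0 // invr_eq0 expf_eq0.
    rewrite !inE !negb_or /= andbT; apply/andP; split.
      by apply: contraNneq nz => -[->].
    by apply: contraNneq nz => -[->]; rewrite sqrrN.
  exists (exist _ (Some z) zS); rewrite xE /pcoord /= zE addrK mulrC divfK //.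
  by rewrite expf_eq0.
move=> f; have [|N [p fE]] := @rational_regular S [::] [:: alpha; - alpha] f.
  by move=> q; rewrite !inE /= orbA orbC.
have ax' : attained phi x' by exists (knA e1 e2 (- 2)).
have ay : attained phi y by exists (knA e1 e2 1).
pose u := mu ^+ 2 *: x'; pose v := mu^-1 *: y.
(* v is the coordinate z, and u is the inverse of z^2 - alpha^2. *)
have -> : f = horner_alg v p * u ^+ N; last first.
  have au : attained phi u := attainedZ _ ax'.
  have av : attained phi v := attainedZ _ ay.
  have ap := attained_horner p av.
  have aN := attainedX N au.
  exact: attainedM ap aN.
apply/esym/val_inj/funext => pt; have /andP[h1 h2] := pt_al pt.
rewrite [LHS](_ : _ = val (horner_alg v p) pt * val (u ^+ N) pt) //.
rewrite regular_horner regular_exp.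
rewrite [val v pt](_ : _ = mu^-1 * val y pt) // yE mulKf // -fE.
rewrite [val u pt](_ : _ = mu ^+ 2 * val x' pt) // x'E.
have -> : (\prod_(a <- [:: alpha; - alpha]) ('X - a%:P)).[pcoord pt] =
    (pcoord pt - alpha) * (pcoord pt + alpha).
  by rewrite !big_cons big_nil mulr1 hornerM !hornerXsubC opprK.
rewrite mulrAC -exprMn.
rewrite (_ : _ * _ * _ = 1) ?expr1n ?mul1r //; field.
by rewrite mu0 h1 h2.
Qed.

(** The condition on e1 and e2 says that x^2 + 3 e1 x + c is the square of x +
    3 e1 / 2, so that y = mu (z - alpha^2 / z) and x = mu^2 z^2 satisfy the
    relation. For surjectivity, a Laurent polynomial in z is split into its
    even part, a Laurent polynomial in x, and its odd part; the latter takes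
    opposite values at alpha and - alpha, so these are 0 if the function
    agrees there, and z^2 - alpha^2 divides it, where z (z^2 - alpha^2) = z^2
    y / mu. *)
Lemma kn_Walg (e1 e2 alpha : C) (g : finLieAlgType C) :
    4 * ((e1 - e2) * (2 * e1 + e2)) = (3 * e1) ^+ 2 -> e1 != 0 -> alpha != 0 ->
  lie_isom (kn_current e1 e2 g) (current g (Walg alpha)).
Proof.
move=> cE e10 al0.
pose S : seq (P1 C) := [:: Some 0; None].
pose glue := [:: (Some alpha : P1 C, Some (- alpha) : P1 C)].
have S_oo : None \in S by rewrite !inE orbT.
have S0 : Some 0 \in S by rewrite !inE eqxx.
pose B := regular_alg S [::].
pose A : comAlgType C := Walg alpha.
have noglue (f : punctured S -> C) (p q : punctured S) :
  (val p, val q) \in [::] -> f p = f q by [].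
pose Z : B := regular_elt (regular_coordinate S_oo) (noglue _).
pose Z' : B := regular_elt (regular_inverse S_oo S0) (noglue _).
have reg (f : B) : regular_outside (val f) by have /asboolP[] := valP f.
have pt0 (pt : punctured S) : pcoord pt != 0.
  have := valP pt; rewrite /= -pcoordE // !inE negb_or => /andP[h1 _].
  by apply: contraNneq h1 => ->.
have glued (f : punctured S -> C) (h : C -> C) :
    (forall pt, f pt = h (pcoord pt)) -> h alpha = h (- alpha) ->
    forall p q : punctured S, (val p, val q) \in glue -> f p = f q.
  move=> fh hal p q; rewrite inE => /eqP[pE qE].
  move: pE qE; rewrite !fh -!pcoordE // => -[->] [->].
  exact: hal.
have [s sE] := sqrt_exists (- (3 * e1) / 2).
have s0 : s != 0.
  by rewrite -sqrf_eq0 sE mulf_neq0 ?invr_eq0 ?oppr_eq0 ?mulf_neq0 ?pnatr_eq0.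
pose mu := s / alpha; have mu0 : mu != 0 by rewrite mulf_neq0 ?invr_eq0.
have muE : mu ^+ 2 * alpha ^+ 2 = - (3 * e1) / 2 by rewrite -exprMn divfK.
pose hx z : C := mu ^+ 2 * (z * z).
pose hx' z : C := mu ^- 2 * (z^-1 * z^-1).
pose hy z : C := mu * z - mu * alpha ^+ 2 / z.
have fx pt : val (mu ^+ 2 *: (Z * Z)) pt = hx (pcoord pt) by [].
have fx' pt : val (mu ^- 2 *: (Z' * Z')) pt = hx' (pcoord pt).
  by rewrite /hx' -[pcoord pt in RHS]subr0.
have fy pt : val (mu *: Z - (mu * alpha ^+ 2) *: Z') pt = hy (pcoord pt).
  by rewrite /hy -[pcoord pt in X in _ / X]subr0.
have hx_al : hx alpha = hx (- alpha) by rewrite /hx mulrNN.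
have hx'_al : hx' alpha = hx' (- alpha) by rewrite /hx' invrN mulrNN.
have hy_al : hy alpha = hy (- alpha).
  by rewrite /hy; field.
pose x : A := regular_elt (reg _) (glued _ _ fx hx_al).
pose x' : A := regular_elt (reg _) (glued _ _ fx' hx'_al).
pose y : A := regular_elt (reg _) (glued _ _ fy hy_al).
have xE pt : val x pt = hx (pcoord pt) by exact: fx.
have x'E pt : val x' pt = hx' (pcoord pt) by exact: fx'.
have yE pt : val y pt = hy (pcoord pt) by exact: fy.
clearbody x x' y.
have xx' : x * x' = 1.
  apply/val_inj/funext => pt.
  rewrite [LHS](_ : _ = val x pt * val x' pt) // [RHS](_ : _ = 1 :> C) //.
  by rewrite xE x'E /hx /hx'; field; rewrite mu0 pt0.
have yy : y * y = x + (3 * e1) *: 1 + ((e1 - e2) * (2 * e1 + e2)) *: x'.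
  apply/val_inj/funext => pt; set c := (e1 - e2) * _ in cE *.
  rewrite [RHS](_ : _ = val x pt + 3 * e1 * 1 + c * val x' pt) //.
  rewrite [LHS](_ : _ = val y pt * val y pt) // xE x'E yE /hx /hx' /hy.
  have -> : 3 * e1 = - 2 * (mu ^+ 2 * alpha ^+ 2) by rewrite muE; field.
  have -> : c = (mu ^+ 2 * alpha ^+ 2) ^+ 2 
    by rewrite muE -[c](@mulKf _ 4) ?pnatr_eq0 // cE; field.
  by field; rewrite mu0 pt0.
have [phi [phi_x phi_x' phi_y]] := kn_mapP xx' yy.
apply: (@kn_current_isom _ _ _ g _ phi).
  rewrite phi_x; apply: regular_transcendental => w w0.
  have [z zE] := sqrt_exists (w / mu ^+ 2).
  have z0 : z != 0 by rewrite -sqrf_eq0 zE mulf_neq0 // invr_eq0 expf_eq0.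
  have zS : Some z \notin S.
    by rewrite !inE orbF; apply: contraNneq z0 => -[->].
  exists (exist _ (Some z) zS).
  rewrite xE /hx /pcoord /= -expr2 zE mulrC divfK //.
  by rewrite expf_eq0.
move=> f; have [|N [p fE]] := @rational_regular S glue [:: 0] f.
  by move=> q; rewrite !inE /= orbC.
(* The factor 'X^N makes the exponent of the denominator z^(2N) even. *)
pose q := p * 'X^N.
have qE pt : q.[pcoord pt] = pcoord pt ^+ N.*2 * val f pt.
  by rewrite /q !hornerE -fE big_seq1 !hornerE subr0 -addnn exprD mulrAC.
pose qo := odd_poly q; pose qe := even_poly q.
have qz z : q.[z] = qe.[z ^+ 2] + qo.[z ^+ 2] * z.
  by rewrite -{1}[q]poly_even_odd !hornerE !horner_comp !hornerE.
have /factor_theorem[r rE] : root qo (alpha ^+ 2).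
  have aS : Some alpha \notin S.
    by rewrite !inE orbF; apply: contraNneq al0 => -[->].
  have NaS : Some (- alpha) \notin S.
    rewrite !inE orbF; apply: contraNneq al0 => -[/eqP].
    by rewrite oppr_eq0 => /eqP ->.
  pose pa : punctured S := exist _ (Some alpha) aS.
  pose pb : punctured S := exist _ (Some (- alpha)) NaS.
  have /asboolP[_ gf] := valP f.
  have fab : val f pa = val f pb by apply: gf; rewrite inE eqxx.
  have := qE pa; have := qE pb.
  rewrite -fab /pcoord /= -mul2n exprM sqrrN -exprM.
  move=> <-; rewrite !qz sqrrN mulrN => /addrI/eqP.
  by rewrite -subr_eq0 opprK -mulr2n mulrn_eq0 /= mulf_eq0 (negPf al0) orbF.
(* Respectively z^2, z^-2 and z - alpha^2 / z. *)
pose u := mu ^- 2 *: x; pose v := mu ^+ 2 *: x'; pose w := mu^-1 *: y.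
have -> : f = v ^+ N * (horner_alg u qe + horner_alg u r * (u * w)); last first.
  have ax : attained phi x by exists (knA e1 e2 2).
  have ax' : attained phi x' by exists (knA e1 e2 (- 2)).
  have ay : attained phi y by exists (knA e1 e2 1).
  have aZ (c : C) (b : A) : attained phi b -> attained phi (c *: b).
    by move=> ab; exact: (attainedZ c ab).
  have au : attained phi u := aZ _ _ ax.
  have av : attained phi v := aZ _ _ ax'.
  have aw : attained phi w := aZ _ _ ay.
  have ao := attainedM (attained_horner r au) (attainedM au aw).
  have ae := attained_horner qe au.
  have aeo := attainedD ae ao.
  have aN := attainedX N av.
  have aNeo := attainedM aN aeo.
  exact: aNeo.
apply/esym/val_inj/funext => pt.
rewrite [LHS](_ : _ = val (v ^+ N) pt * (val (horner_alg u qe) pt +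
  val (horner_alg u r) pt * (val u pt * val w pt))) //.
rewrite !regular_horner regular_exp; set z := pcoord pt.
have z0 : z != 0 := pt0 pt.
have -> : val u pt = z ^+ 2.
  by rewrite [LHS](_ : _ = mu ^- 2 * val x pt) // xE -/z /hx; field.
have -> : val v pt = z ^- 2.
  rewrite [LHS](_ : _ = mu ^+ 2 * val x' pt) // x'E -/z /hx'.
  by field; rewrite mu0 z0.
have -> : z ^+ 2 * val w pt = (z ^+ 2 - alpha ^+ 2) * z.
  rewrite [X in _ * X](_ : _ = mu^-1 * val y pt) // yE -/z /hy.
  by field; rewrite mu0 z0.
have qzE := qE pt; rewrite -/z qz rE !hornerE in qzE.
rewrite mulrA qzE -mul2n exprM mulrA -exprMn mulVf ?expr1n ?mul1r //.
by rewrite expf_eq0.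
Qed.
End NodalCurves.

Theorem proposition5p2 (R : realType) (g : finLieAlgType R[i]) :
  [/\ lie_isom (kn_current (0 : R[i]) 0 g) (current g (laurent R[i])),
      forall e1 e1' : R[i], e1 != 0 -> e1' != 0 ->
        lie_isom (kn_current e1 (1 * e1) g) (kn_current e1' (- 2 * e1') g),
      forall e1 alpha : R[i], e1 != 0 -> alpha != 0 ->
        lie_isom (kn_current e1 (- 2 * e1) g) (current g (Valg alpha))
    & forall e1 alpha : R[i], e1 != 0 -> alpha != 0 ->
        lie_isom (kn_current e1 (- (1 / 2) * e1) g) (current g (Walg alpha))].
Proof.
have sqrtP (a : R[i]) : exists b, b ^+ 2 = a.
  by exists (sqrtc a); rewrite sqr_sqrtc.
have V e1 e2 alpha := @kn_Valg _ sqrtP (@regular_rational R) e1 e2 alpha g.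
have W e1 e2 alpha := @kn_Walg _ sqrtP (@regular_rational R) e1 e2 alpha g.
have V2 (e1 alpha : R[i]) : e1 != 0 -> alpha != 0 ->
    lie_isom (kn_current e1 (- 2 * e1) g) (current g (Valg alpha)).
  by move=> e10 al0; apply: V => //; ring.
split=> // [|e1 e1' e10 e10'|e1 alpha e10 al0].
- exact: kn_laurent.
(* Both algebras are isomorphic to the one of the punctured sphere. *)
- apply: lie_isom_trans (lie_isom_sym (V2 e1' 1 e10' (oner_neq0 _))).
  by apply: V; rewrite ?oner_neq0 //; ring.
by apply: W => //; field.
Qed.
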